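(* Let $m,n,q$ be positive integers, $\Omega\subset\mathbb{R}^m$ an open set and $f:\Omega\to\mathbf{Q}_q(\mathbb{R}^n)$ a multiple-valued function. The following statements are equivalent: (1) $f$ is affinely approximable at every point of $\Omega$ and $Df:\Omega\to\mathbf{Q}_q(\mathrm{Hom}(\mathbb{R}^m,\mathbb{R}^n))$ is continuous. (2) There exists $\Phi:\Omega\to\mathbf{Q}_q(\mathbb{P}^1(\mathbb{R}^m,\mathbb{R}^n))$ such that (a) $\mathrm{P}_{a,\Phi(a)}(a)=f(a)$ for all $a\in\Omega$; and (b) for every compact set $K\subset\Omega$ and every $\varepsilon\in(0,\infty)$ there exists $\delta\in(0,\infty)$ such that if $a,b\in K$ satisfy $\|b-a\|<\delta$, then $$\mathcal{F}\big(\mathrm{P}_{a,\Phi(a)}(x),\mathrm{P}_{b,\Phi(b)}(x)\big)\leq\varepsilon\|b-a\|\quad\text{for all } x\in\mathbf{U}(a,\|b-a\|).$$ (3) $f$ is affinely approximable at every point of $\Omega$ and $\mathrm{T}^1f:\Omega\to\mathbf{Q}_q(\mathbb{P}^1(\mathbb{R}^m,\mathbb{R}^n))$ is continuous.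
   Context: For a finite-dimensional normed vector space $W$ and a positive integer $q$, $\mathbf{Q}_q(W)$ is the set of measures $T=\sum_{\alpha=1}^q[\![y_\alpha]\!]$ with $y_1,\dots,y_q\in W$ not necessarily distinct, where $[\![y]\!]$ is the Dirac measure at $y$ (i.e. unordered $q$-tuples of points of $W$). It is endowed with the metric $\mathcal{F}\big(\sum_\alpha[\![y_\alpha]\!],\sum_\alpha[\![z_\alpha]\!]\big)=\min_{\sigma\in\Pi_q}\sum_{\alpha=1}^q\|y_\alpha-z_{\sigma(\alpha)}\|_W$, where $\Pi_q$ is the set of permutations of $\{1,\dots,q\}$. Euclidean spaces carry the Euclidean norm and $\mathrm{Hom}(V,W)$ (linear maps) the operator norm. $\mathbf{U}(a,r)$ is the open ball of center $a$ and radius $r$ (empty if $r=0$). $f:\Omega\to\mathbf{Q}_q(\mathbb{R}^n)$ is affinely approximable at $a\in\Omega$ (an interior point of $\Omega$) if there exist affine maps $A_1,\dots,A_q:\mathbb{R}^m\to\mathbb{R}^n$ such that $\lim_{x\to a}\|x-a\|^{-1}\mathcal{F}\big(f(x),\sum_{\alpha=1}^q[\![A_\alpha(x)]\!]\big)=0$. The unordered tuple $\sum_\alpha[\![A_\alpha]\!]$ is then unique. Let $L_\alpha\in\mathrm{Hom}(\mathbb{R}^m,\mathbb{R}^n)$ be the linear part of $A_\alpha$, $L_\alpha(v)=A_\alpha(v)-A_\alpha(0)$. Define $Df(a)=\sum_{\alpha=1}^q[\![L_\alpha]\!]\in\mathbf{Q}_q(\mathrm{Hom}(\mathbb{R}^m,\mathbb{R}^n))$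 and $\mathrm{T}^1f(a)=\sum_{\alpha=1}^q[\![(A_\alpha(a),L_\alpha)]\!]\in\mathbf{Q}_q(\mathbb{P}^1(\mathbb{R}^m,\mathbb{R}^n))$. Here $\mathbb{P}^1(\mathbb{R}^m,\mathbb{R}^n)=\mathbb{R}^n\oplus\mathrm{Hom}(\mathbb{R}^m,\mathbb{R}^n)$ is the space of polynomial functions of degree at most $1$, with norm $\|(y,L)\|=\|y\|+\|L\|$; an element $\phi=(y,L)$ is evaluated as $\phi(x)=y+L(x)$. For $\Phi_0=\sum_{\alpha=1}^q[\![\phi_\alpha]\!]\in\mathbf{Q}_q(\mathbb{P}^1(\mathbb{R}^m,\mathbb{R}^n))$ and $a\in\mathbb{R}^m$, the map $\mathrm{P}_{a,\Phi_0}:\mathbb{R}^m\to\mathbf{Q}_q(\mathbb{R}^n)$ is $\mathrm{P}_{a,\Phi_0}(x)=\sum_{\alpha=1}^q[\![\phi_\alpha(x-a)]\!]$.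
   Formalization: Affine approximability at a is taken to include f(a)=Σ[[A_α(a)]] besides the limit over x≠a; without it the equivalence fails, e.g. for m=n=q=1 and f=[[0]] except [[1]] at one point, where (1) and (3) hold but (2) does not. *)

(* Defs.v *)
From HB Require Import structures.
From mathcomp Require Import all_boot all_order all_algebra all_fingroup.
From mathcomp Require Import generic_quotient ring.
From mathcomp Require Import all_classical all_reals all_analysis.

Set Implicit Arguments.
Unset Strict Implicit.
Unset Printing Implicit Defensive.

Import Order.TTheory GRing.Theory Num.Theory.
Import numFieldNormedType.Exports.

Local Open Scope classical_set_scope.
Local Open Scope ring_scope.

(* The library norms 'rV[R]_n by the supremum norm; euclid R n is the same
   vector space with the Euclidean norm (and the metric and topology it
   induces). *)
Definition euclid (R : realType) (n : nat) : Type := 'rV[R]_n.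

HB.instance Definition _ (R : realType) (n : nat) :=
  Vector.copy (euclid R n) 'rV[R]_n.

Section EuclideanNorm.
Variables (R : realType) (n : nat).
Implicit Types x y : euclid R n.

Definition enorm x : R := Num.sqrt (\sum_(i < n) (x : 'rV[R]_n) 0 i ^+ 2).

Let sumsq_ge0 x : 0 <= \sum_(i < n) (x : 'rV[R]_n) 0 i ^+ 2.
Proof. by apply: sumr_ge0 => i _; exact: sqr_ge0. Qed.

Let enorm_sqr x : enorm x ^+ 2 = \sum_(i < n) (x : 'rV[R]_n) 0 i ^+ 2.
Proof. by rewrite /enorm sqr_sqrtr. Qed.

Let enorm_ge0 x : 0 <= enorm x. Proof. exact: sqrtr_ge0. Qed.

Lemma enorm0_eq0 x : enorm x = 0 -> x = 0.
Proof.
move=> x0; have := enorm_sqr x; rewrite x0 expr0n /= => /esym/eqP.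
rewrite psumr_eq0 => [/allP h|i _]; last exact: sqr_ge0.
apply/rowP => i; rewrite mxE; apply/eqP.
by have := h i (mem_index_enum i); rewrite sqrf_eq0.
Qed.

Lemma enormZ (l : R) x : enorm (l *: x) = `|l| * enorm x.
Proof.
rewrite /enorm -sqrtr_sqr -sqrtrM ?sqr_ge0// mulr_sumr.
by congr Num.sqrt; apply: eq_bigr => i _; rewrite mxE exprMn.
Qed.

Let cauchy_schwarz x y :
  \sum_(i < n) (x : 'rV[R]_n) 0 i * (y : 'rV[R]_n) 0 i <= enorm x * enorm y.
Proof.
have [x0|x_neq0] := eqVneq (enorm x) 0.
  by rewrite x0 (enorm0_eq0 x0) mul0r big1// => i _; rewrite mxE mul0r.
have [y0|y_neq0] := eqVneq (enorm y) 0.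
  by rewrite y0 (enorm0_eq0 y0) mulr0 big1// => i _; rewrite mxE mulr0.
have XY : 0 < enorm x * enorm y.
  by rewrite mulr_gt0// lt_neqAle eq_sym enorm_ge0 ?x_neq0 ?y_neq0.
rewrite -(ler_pM2l XY).
have : 0 <= \sum_(i < n) (enorm y * (x : 'rV[R]_n) 0 i
                         - enorm x * (y : 'rV[R]_n) 0 i) ^+ 2.
  by apply: sumr_ge0 => i _; exact: sqr_ge0.
set s := \sum_(i < n) _ * _.
have -> : \sum_(i < n) (enorm y * (x : 'rV[R]_n) 0 i
                         - enorm x * (y : 'rV[R]_n) 0 i) ^+ 2 =
    (enorm x * enorm y * (enorm x * enorm y) - enorm x * enorm y * s) *+ 2.
  transitivity (enorm y ^+ 2 * enorm x ^+ 2 + enorm x ^+ 2 * enorm y ^+ 2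
                - (enorm x * enorm y * s) *+ 2).
    rewrite {1}(enorm_sqr x) {2}(enorm_sqr y) /s !mulr_sumr -sumrMnl -sumrN.
    rewrite -!big_split/=; apply: eq_bigr => i _.
    by ring.
  rewrite mulrnBl; congr (_ - _).
  by rewrite (mulrC (enorm y ^+ 2)) -mulr2n -exprMn expr2.
by rewrite pmulrn_lge0// subr_ge0.
Qed.

Lemma ler_enormD x y : enorm (x + y) <= enorm x + enorm y.
Proof.
rewrite -(ler_pXn2r (ltn0Sn 1)) ?nnegrE ?addr_ge0//.
rewrite enorm_sqr sqrrD !enorm_sqr.
have -> : \sum_(i < n) (x + y : 'rV[R]_n) 0 i ^+ 2 =
    \sum_(i < n) (x : 'rV[R]_n) 0 i ^+ 2 +
    (\sum_(i < n) (x : 'rV[R]_n) 0 i * (y : 'rV[R]_n) 0 i) *+ 2 +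
    \sum_(i < n) (y : 'rV[R]_n) 0 i ^+ 2.
  rewrite -sumrMnl -!big_split; apply: eq_bigr => i _ /=.
  by rewrite mxE sqrrD.
by rewrite lerD2r lerD2l lerMn2r cauchy_schwarz.
Qed.

HB.instance Definition _ :=
  @Lmodule_isNormed.Build R (euclid R n) enorm ler_enormD enormZ enorm0_eq0.

Lemma euclid_normE x :
  `|x| = Num.sqrt (\sum_(i < n) (x : 'rV[R]_n) 0 i ^+ 2).
Proof. by []. Qed.

Lemma euclid_coord_le x i : `|(x : 'rV[R]_n) 0 i| <= `|x|.
Proof.
rewrite -sqrtr_sqr ler_wsqrtr// (bigD1 i)//= lerDl.
by apply: sumr_ge0 => j _; exact: sqr_ge0.
Qed.

End EuclideanNorm.

(* Hom(R^m, R^n) with the operator norm. *)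
Definition linhom (R : realType) (m n : nat) : Type :=
  'Hom(euclid R m, euclid R n).

HB.instance Definition _ (R : realType) (m n : nat) :=
  Vector.copy (linhom R m n) 'Hom(euclid R m, euclid R n).

Definition lapp (R : realType) (m n : nat) (L : linhom R m n)
  : euclid R m -> euclid R n := fun_of_lfun L.

Section OperatorNorm.
Variables (R : realType) (m n : nat).
Implicit Types (L : linhom R m n) (v : euclid R m).

Definition opnorm L : R := sup [set `|lapp L v| | v in [set v | `|v| <= 1]].

Let lappZ L (c : R) v : lapp L (c *: v) = c *: lapp L v.
Proof. exact: linearZ. Qed.

Let opnorm_has_sup L :
  has_sup [set `|lapp L v| | v in [set v : euclid R m | `|v| <= 1]].
Proof.
split; first by exists `|lapp L 0|; exists 0 => //=; rewrite normr0.
exists (\sum_(i < m) `|lapp L (delta_mx 0 i : 'rV[R]_m)|) => _ [v /= v1 <-].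
rewrite {1}[v]row_sum_delta /lapp linear_sum.
apply: (le_trans (ler_norm_sum _ _ _)); apply: ler_sum => i _.
rewrite linearZ normrZ ler_piMl//.
exact: le_trans (euclid_coord_le v i) v1.
Qed.

Let lapp_le_opnorm1 L v : `|v| <= 1 -> `|lapp L v| <= opnorm L.
Proof.
by move=> v1; apply: (sup_upper_bound (opnorm_has_sup L)); exists v.
Qed.

Let opnorm_le L (c : R) : (forall v, `|v| <= 1 -> `|lapp L v| <= c) ->
  opnorm L <= c.
Proof.
move=> h; apply: ge_sup; first by case: (opnorm_has_sup L).
by move=> _ [v /= v1 <-]; exact: h.
Qed.

Let opnorm_ge0 L : 0 <= opnorm L.
Proof.
by apply: le_trans (lapp_le_opnorm1 L (v := 0) _) => //; rewrite normr0.
Qed.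

Let le_lapp L v : `|lapp L v| <= opnorm L * `|v|.
Proof.
have [->|v0] := eqVneq v 0.
  by rewrite /lapp linear0 !normr0 mulr0.
have nv : 0 < `|v| by rewrite normr_gt0.
rewrite -ler_pdivrMr//.
have := @lapp_le_opnorm1 L (`|v|^-1 *: v).
rewrite lappZ !normrZ normfV normr_id mulVf ?gt_eqF// mulrC; exact.
Qed.

Lemma ler_opnormD L1 L2 : opnorm (L1 + L2) <= opnorm L1 + opnorm L2.
Proof.
apply: opnorm_le => v v1; rewrite /lapp lfunE/=.
by apply: (le_trans (ler_normD _ _)); apply: lerD; exact: lapp_le_opnorm1.
Qed.

Let opnormZ_le (l : R) L : opnorm (l *: L) <= `|l| * opnorm L.
Proof.
apply: opnorm_le => v v1; rewrite /lapp lfunE/= normrZ.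
by rewrite ler_wpM2l//; exact: lapp_le_opnorm1.
Qed.

Lemma opnormZ (l : R) L : opnorm (l *: L) = `|l| * opnorm L.
Proof.
apply/eqP; rewrite eq_le opnormZ_le/=.
have [->|l0] := eqVneq l 0; first by rewrite normr0 mul0r.
rewrite -ler_pdivlMl ?normr_gt0// -normfV.
by rewrite -{1}[L]scale1r -(mulVf l0) -scalerA opnormZ_le.
Qed.

Lemma opnorm0_eq0 L : opnorm L = 0 -> L = 0.
Proof.
move=> L0; apply/lfunP => v; rewrite lfunE/=; apply/eqP.
by rewrite -normr_le0; have := le_lapp L v; rewrite L0 mul0r.
Qed.

HB.instance Definition _ :=
  @Lmodule_isNormed.Build R (linhom R m n) opnorm
    ler_opnormD opnormZ opnorm0_eq0.

Lemma ler_lapp L v : `|lapp L v| <= `|L| * `|v|.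
Proof. exact: le_lapp. Qed.

End OperatorNorm.

(* Polynomial functions R^m -> R^n of degree at most 1. The library norms a
   product by the maximum; here the norm is the sum. *)
Definition poly1 (R : realType) (m n : nat) : Type :=
  (euclid R n * linhom R m n)%type.

HB.instance Definition _ (R : realType) (m n : nat) :=
  Vector.copy (poly1 R m n) (euclid R n * linhom R m n)%type.

Section Poly1Norm.
Variables (R : realType) (m n : nat).
Implicit Types phi psi : poly1 R m n.

Definition poly1_norm phi : R := `|phi.1| + `|phi.2|.

Lemma ler_poly1_normD phi psi :
  poly1_norm (phi + psi) <= poly1_norm phi + poly1_norm psi.
Proof. by rewrite /poly1_norm addrACA; apply: lerD; exact: ler_normD. Qed.

Lemma poly1_normZ (l : R) phi : poly1_norm (l *: phi) = `|l| * poly1_norm phi.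
Proof. by rewrite /poly1_norm !normrZ mulrDr. Qed.

Lemma poly1_norm0_eq0 phi : poly1_norm phi = 0 -> phi = 0.
Proof.
move=> /eqP; rewrite /poly1_norm paddr_eq0// !normr_eq0 => /andP[/eqP p1 /eqP p2].
by case: phi p1 p2 => y L /= -> ->.
Qed.

HB.instance Definition _ :=
  @Lmodule_isNormed.Build R (poly1 R m n) poly1_norm
    ler_poly1_normD poly1_normZ poly1_norm0_eq0.

Definition poly1_eval phi (x : euclid R m) : euclid R n :=
  phi.1 + lapp phi.2 x.

End Poly1Norm.

(* Q_q(W): unordered q-tuples of points of W. *)
Section UnorderedTuples.
Variables (q : nat) (W : choiceType).

Definition tperm_eq (s t : q.-tuple W) : bool := perm_eq s t.

Lemma tperm_eq_refl : reflexive tperm_eq.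
Proof. by move=> s; exact: perm_refl. Qed.

Lemma tperm_eq_sym : symmetric tperm_eq.
Proof. by move=> s t; exact: perm_sym. Qed.

Lemma tperm_eq_trans : transitive tperm_eq.
Proof. by move=> t s u; exact: perm_trans. Qed.

Canonical tperm_equiv :=
  EquivRel tperm_eq tperm_eq_refl tperm_eq_sym tperm_eq_trans.

Definition Qspace : Type := {eq_quot tperm_equiv}%qT.

HB.instance Definition _ := Choice.copy Qspace {eq_quot tperm_equiv}%qT.

Definition Qpi (s : q.-tuple W) : Qspace := (\pi_({eq_quot tperm_equiv}) s)%qT.

Definition Qrepr (T : Qspace) : q.-tuple W :=
  repr (T : {eq_quot tperm_equiv}%qT).

(* The sum of the Dirac masses at y_1, ..., y_q. *)
Definition dsum (y : 'I_q -> W) : Qspace := Qpi (mktuple y).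

Lemma QreprK T : Qpi (Qrepr T) = T.
Proof. by rewrite /Qpi /Qrepr; exact: reprK. Qed.

Lemma Qpi_eqP (s t : q.-tuple W) : Qpi s = Qpi t <-> perm_eq s t.
Proof. by split => [/eqP|h]; [rewrite eqmodE|apply/eqP; rewrite eqmodE]. Qed.

Lemma Qrepr_pi (s : q.-tuple W) : perm_eq (Qrepr (Qpi s)) s.
Proof. by apply/Qpi_eqP; rewrite QreprK. Qed.

Lemma dsum_surj T : exists y, T = dsum y.
Proof.
exists (tnth (Qrepr T)); rewrite -[LHS]QreprK /dsum; congr Qpi.
by apply/eq_from_tnth => i; rewrite tnth_mktuple.
Qed.

Lemma dsum_eqP (y z : 'I_q -> W) :
  dsum y = dsum z <-> exists s : 'S_q, forall i, y i = z (s i).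
Proof.
rewrite /dsum; split => [/Qpi_eqP/tuple_permP[s /val_inj ys]|[s ys]].
  exists s => i; rewrite -[y i](tnth_mktuple y) ys.
  by rewrite !tnth_mktuple.
apply/Qpi_eqP/tuple_permP; exists s; congr (tval _).
by apply/eq_from_tnth => i; rewrite !tnth_mktuple.
Qed.

End UnorderedTuples.

Definition Qmap (q : nat) (V W : choiceType) (g : V -> W) (T : Qspace q V)
  : Qspace q W := Qpi (map_tuple g (Qrepr T)).

Lemma Qmap_dsum (q : nat) (V W : choiceType) (g : V -> W) (y : 'I_q -> V) :
  Qmap g (dsum y) = dsum (g \o y).
Proof.
have -> : dsum (g \o y) = Qpi (map_tuple g (mktuple y)).
  rewrite /dsum; congr Qpi; apply/eq_from_tnth => i.
  by rewrite tnth_mktuple tnth_map tnth_mktuple.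
by apply/Qpi_eqP; apply: perm_map; exact: Qrepr_pi.
Qed.

Section QMetric.
Variables (R : realType) (q : nat) (W : normedModType R).
Implicit Types (y z : 'I_q -> W) (s t : 'S_q) (S T U : Qspace q W).

Definition matching_cost y z s : R := \sum_(i < q) `|y i - z (s i)|.

(* The minimum over all permutations; starting the iterated minimum at the cost
   of the identity does not change its value. *)
Definition matching_dist y z : R :=
  \big[Order.min/matching_cost y z 1%g]_(s : 'S_q) matching_cost y z s.

Definition Qdist S T : R :=
  matching_dist (tnth (Qrepr S)) (tnth (Qrepr T)).

Lemma matching_dist_le y z s : matching_dist y z <= matching_cost y z s.
Proof. exact: bigmin_le_cond. Qed.

Lemma matching_dist_attained y z :
  exists s, matching_dist y z = matching_cost y z s.
Proof.
rewrite /matching_dist; elim/big_ind: _ => [|a b [s ->] [t ->]|s _].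
- by exists 1%g.
- by rewrite /Order.min; case: ifP; [exists s|exists t].
- by exists s.
Qed.

Let matching_dist_perm y z y' z' s t :
  (forall i, y i = y' (s i)) -> (forall i, z i = z' (t i)) ->
  matching_dist y z <= matching_dist y' z'.
Proof.
move=> ys zt; have [u ->] := matching_dist_attained y' z'.
apply: le_trans (matching_dist_le y z (s * u * t^-1)%g) _.
rewrite /matching_cost [leRHS](reindex_inj (@perm_inj _ s))/= le_eqVlt.
by apply/orP; left; apply/eqP/eq_bigr => i _; rewrite ys zt !permM permKV.
Qed.

Lemma Qdist_dsum y z : Qdist (dsum y) (dsum z) = matching_dist y z.
Proof.
have rep (x : 'I_q -> W) : exists s : 'S_q, forall i, tnth (Qrepr (dsum x)) i = x (s i).
  apply/dsum_eqP; rewrite -[RHS]QreprK [LHS]/dsum; congr Qpi.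
  by apply/eq_from_tnth => i; rewrite tnth_mktuple.
have [s ys] := rep y; have [t zt] := rep z.
apply/eqP; rewrite eq_le (matching_dist_perm ys zt)/=.
apply: (@matching_dist_perm _ _ _ _ s^-1%g t^-1%g) => i.
  by rewrite ys permKV.
by rewrite zt permKV.
Qed.

Let Qdistxx S : Qdist S S = 0.
Proof.
apply/eqP; rewrite eq_le; apply/andP; split.
  apply: le_trans (matching_dist_le _ _ 1%g) _.
  by rewrite /matching_cost big1// => i _; rewrite perm1 subrr normr0.
have [s] := matching_dist_attained (tnth (Qrepr S)) (tnth (Qrepr S)).
by rewrite /Qdist => ->; apply: sumr_ge0.
Qed.

Let Qdist_eq0 S T : Qdist S T = 0 -> S = T.
Proof.
have [y ->] := dsum_surj S; have [z ->] := dsum_surj T; rewrite Qdist_dsum.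
have [s ->] := matching_dist_attained y z => /eqP.
rewrite psumr_eq0// => /allP h; apply/dsum_eqP; exists s => i.
have := h i (mem_index_enum i); rewrite normr_eq0 subr_eq0.
by move=> /eqP.
Qed.

Let Qdist_sym S T : Qdist S T = Qdist T S.
Proof.
wlog: S T / Qdist T S <= Qdist S T => [H|le_TS].
  by case/orP: (le_total (Qdist S T) (Qdist T S)) => ?; [apply/esym|]; exact: H.
apply/eqP; rewrite eq_le le_TS andbT.
have [s] := matching_dist_attained (tnth (Qrepr T)) (tnth (Qrepr S)).
rewrite /Qdist => ->; apply: le_trans (matching_dist_le _ _ s^-1%g) _.
rewrite /matching_cost (reindex_inj (@perm_inj _ s))/= le_eqVlt.
by apply/orP; left; apply/eqP/eq_bigr => i _; rewrite permK distrC.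
Qed.

Let Qdist_triangle T S U : Qdist S U <= Qdist S T + Qdist T U.
Proof.
have [s] := matching_dist_attained (tnth (Qrepr S)) (tnth (Qrepr T)).
have [t] := matching_dist_attained (tnth (Qrepr T)) (tnth (Qrepr U)).
rewrite /Qdist => -> ->; apply: le_trans (matching_dist_le _ _ (s * t)%g) _.
rewrite /matching_cost [X in _ <= _ + X](reindex_inj (@perm_inj _ s))/=.
rewrite -big_split/=; apply: ler_sum => i _; rewrite permM.
exact: ler_distD.
Qed.

HB.instance Definition _ :=
  @isMetric.Build R (Qspace q W) Qdist
    Qdistxx Qdist_eq0 Qdist_sym Qdist_triangle.

Lemma Qspace_mdistE S T : mdist S T = Qdist S T.
Proof. by []. Qed.

End QMetric.

Section MultipleValuedMaps.
Variables (R : realType) (m n q : nat).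
Local Notation E := (euclid R).

Definition linear_part (A : E m -> E n) : linhom R m n :=
  linfun (fun v : E m => A v - A 0).

Definition affine_map (A : E m -> E n) : Prop :=
  linear (fun v : E m => A v - A 0).

Lemma linear_partE (A : E m -> E n) (v : E m) :
  affine_map A -> lapp (linear_part A) v = A v - A 0.
Proof.
move=> linA; pose g v := A v - A 0.
pose gL := GRing.isLinear.Build R (E m) (E n) *:%R g linA.
pose B : {linear E m -> E n} := HB.pack g gL.
by rewrite /lapp /linear_part (lfunE B).
Qed.

Definition Paf (a : E m) (Phi0 : Qspace q (poly1 R m n)) (x : E m)
  : Qspace q (E n) := Qmap (fun phi => poly1_eval phi (x - a)) Phi0.

Implicit Types (f : E m -> Qspace q (E n)) (a : E m).

(* The limit is read with x = a allowed: the distance is o(|x - a|) on a full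
   neighbourhood of a, as for an ordinary differential. As |x - a|^-1 is 0 at
   x = a in the library, this is rendered by a limit over x != a together with
   the equality at a; the limit over x != a alone would not constrain f a. *)
Definition affine_approx f a (A : 'I_q -> E m -> E n) : Prop :=
  [/\ forall i, affine_map (A i),
      f a = dsum (fun i => A i a) &
      `|x - a|^-1 * mdist (f x) (dsum (fun i => A i x)) @[x --> a^'] --> (0 : R)].

Definition affinely_approximable f a : Prop := exists A, affine_approx f a A.

(* The tuple of the A i is unique up to order; where f is not affinely
   approximable, Df and T1f take an arbitrary default value. *)
Definition Df f a : Qspace q (linhom R m n) :=
  xget (dsum (fun=> 0))
    [set T | exists2 A, affine_approx f a A &
                        T = dsum (fun i => linear_part (A i))].

Definition T1f f a : Qspace q (poly1 R m n) :=
  xget (dsum (fun=> 0))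
    [set T | exists2 A, affine_approx f a A &
        T = dsum (fun i => (A i a, linear_part (A i)) : poly1 R m n)].

End MultipleValuedMaps.

(* Main.v *)
(* The implication (1) => (2), with Phi = T^1 f, rests on a mean value inequality
   for f along a segment on which Df is nearly constant. The difficulty is that
   Df does not record which derivative belongs to which branch. Composing with
   finitely many linear forms on R^n reduces to real branches of one variable.
   There, the sum S_k of the k largest values has at each time a two-sided
   subgradient, which is a k-fold sum of velocities; as the velocities are
   continuous as an unordered tuple, these subgradients stay close to a finite
   set. If c avoids that set then S_k - c t has no interior maximum, as in
   Darboux's theorem for derivatives, so the one-sided slopes of S_k cannot jump.
   Taking differences in k, values and velocities vary continuously together, and
   a branch keeps its velocity near one cluster of initial velocities for all
   times.

   For (2) => (3) and for the uniqueness of the affine approximation one compares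
   two tuples of affine maps on a ball: at many points of a moment curve the
   permutation matching them is, by the pigeonhole principle, the same at m + 1
   points, and a Vandermonde system then compares the coefficients. *)
Require Import Defs.
From mathcomp Require Import all_boot all_order all_algebra.
From mathcomp Require Import all_fingroup ring lra.
From mathcomp Require Import all_classical all_reals all_analysis.
Set Implicit Arguments.
Unset Strict Implicit.
Unset Printing Implicit Defensive.
Import Order.TTheory GRing.Theory Num.Theory.
Import numFieldNormedType.Exports.
Local Open Scope classical_set_scope.
Local Open Scope ring_scope.

(** * Sums of the largest entries of a real tuple *)

(** Stated for an arbitrary total order because branches are later sorted as pairs (value,
    velocity), lexicographically. *)
Lemma sorting_perm (d : Order.disp_t) (T : orderType d) (q : nat)
    (x : 'I_q -> T) :
  exists s : 'S_q, forall i j : 'I_q, (i <= j)%N -> (x (s j) <= x (s i))%O.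
Proof.
pose t := [tuple x i | i < q]; pose st := sort_tuple (fun a b => (b <= a)%O) t.
have /tuple_permP[s st_s] : perm_eq st t by rewrite perm_sort perm_refl.
have nthst (i : 'I_q) : tnth st i = x (s i).
  by rewrite (val_inj st_s) !tnth_mktuple.
exists s => i j ij; rewrite -!nthst.
have sorted_st : sorted (fun a b => (b <= a)%O) st.
  by apply: sort_sorted => a b; exact: le_total.
rewrite (tnth_nth (x i)) [X in (_ <= X)%O](tnth_nth (x i)).
apply: (@sorted_leq_nth _ (fun a b : T => (b <= a)%O)) => //.
- by move=> b a c ba cb; exact: le_trans cb ba.
- by rewrite inE size_tuple.
- by rewrite inE size_tuple.
Qed.

Section TopSums.
Variables (R : realType) (q : nat).
Implicit Types x y : 'I_q -> R.

(** The first [k] entries are the [k] largest only when [x] is antitone. *)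
Definition top_sum (k : nat) x : R := \sum_(i < q | (i < k)%N) x i.

Definition antitone x := forall i j : 'I_q, (i <= j)%N -> x j <= x i.

(** For [k < q], subtract the entry of index [k]. A partial sum of the permuted differences is at
    most the sum of all positive parts, which ignores the permutation and, for antitone [x], is
    carried by the first [k] entries. *)
Lemma top_sum_le x (p : 'S_q) k : antitone x ->
  top_sum k (fun i => x (p i)) <= top_sum k x.
Proof.
move=> dx; have [kq|qk] := ltnP k q; last first.
  have E y : top_sum k y = \sum_i y i.
    by apply: eq_bigl => i; rewrite (leq_trans _ qk).
  by rewrite !E [leRHS](reindex_inj (@perm_inj _ p)).
pose th := x (Ordinal kq).
have E y : top_sum k y = \sum_(i < q | (i < k)%N) (y i - th)
                        + \sum_(i < q | (i < k)%N) th.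
  by rewrite -big_split/=; apply: eq_bigr => i _; rewrite subrK.
rewrite !E lerD2r.
apply: (@le_trans _ _ (\sum_i Num.max (x (p i) - th) 0)).
  rewrite big_mkcond/=; apply: ler_sum => i _.
  by case: ifP => _; rewrite le_max lexx ?orbT.
have -> : \sum_i Num.max (x (p i) - th) 0 = \sum_i Num.max (x i - th) 0.
  by rewrite [RHS](reindex_inj (@perm_inj _ p)).
rewrite [leRHS]big_mkcond/=; apply: ler_sum => i _.
case: ifPn => [ik|]; first by rewrite ge_max lexx subr_ge0 dx//= ltnW.
by rewrite -leqNgt => ki; rewrite ge_max lexx subr_le0 dx.
Qed.

Lemma top_sum_shift x y (p : 'S_q) e k : antitone y -> 0 <= e ->
  (forall i, x (p i) <= y i + e) -> top_sum k x <= top_sum k y + q%:R * e.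
Proof.
move=> dy e0 xy; apply: (@le_trans _ _ (top_sum k (fun i => y (p^-1%g i) + e))).
  by apply: ler_sum => i _; rewrite -{1}(permKV p i).
rewrite /top_sum big_split/= lerD ?top_sum_le//.
rewrite -[q in leRHS]card_ord mulr_natl -sumr_const big_mkcond/=.
by apply: ler_sum => i _; case: ifP.
Qed.

Lemma top_sumS k x (kq : (k < q)%N) :
  top_sum k.+1 x = top_sum k x + x (Ordinal kq).
Proof.
rewrite /top_sum (bigD1 (Ordinal kq)) //= addrC; congr (_ + _).
by apply: eq_bigl => i; rewrite ltnS -val_eqE/= andbC -ltn_neqAle.
Qed.

Lemma top_sum_coord x y e : (forall k, (k <= q)%N -> `|top_sum k x - top_sum k y| <= e) ->
  forall i, `|x i - y i| <= 2 * e.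
Proof.
move=> h i; have := top_sumS x (ltn_ord i); have := top_sumS y (ltn_ord i).
have -> : Ordinal (ltn_ord i) = i by exact/val_inj.
by move: (h i (ltnW (ltn_ord i))) (h i.+1 (ltn_ord i)); rewrite !ler_norml; lra.
Qed.

(** Any matching within [e] bounds the difference of all top sums by [q%:R * e], and an entry is the
    difference of two consecutive top sums. Hence the sorted order is itself a matching, at a
    bounded loss. *)
Lemma antitone_match x y (p : 'S_q) e : antitone x -> antitone y -> 0 <= e ->
  (forall i, `|x (p i) - y i| <= e) ->
  forall i, `|x i - y i| <= 2 * (q%:R * e).
Proof.
move=> dx dy e0 xy; apply: top_sum_coord => k _.
have h1 : top_sum k x <= top_sum k y + q%:R * e.
  by apply: (@top_sum_shift _ _ p) => // i; move: (xy i); rewrite ler_norml; lra.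
have h2 : top_sum k y <= top_sum k x + q%:R * e.
  apply: (@top_sum_shift _ _ p^-1%g) => // i; move: (xy (p^-1%g i)).
  by rewrite permKV ler_norml; lra.
by rewrite ler_norml; lra.
Qed.

End TopSums.

(** * Functions with two-sided approximate subgradients *)

Section Supports.
Variable R : realType.
Implicit Types (h : R -> R) (a b s r c : R).

(* The bound is required on both sides of s, so it fails at a concave kink. *)
Definition supports h s c := forall e, 0 < e ->
  \forall r \near s, h s + c * (r - s) - e * `|r - s| <= h r.

Lemma supports_gt_right h s c : supports h s c -> 0 < c ->
  \forall r \near s^'+, h s < h r.
Proof.
move=> hc c0; have c2 : 0 < c / 2 by rewrite divr_gt0.
near=> r; have sr : s < r by near: r; exact: nbhs_right_gt.
have : h s + c * (r - s) - c / 2 * `|r - s| <= h r.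
  by near: r; exact: cvg_within (hc _ c2).
have : 0 < c * (r - s) by rewrite mulr_gt0 ?subr_gt0.
by rewrite gtr0_norm ?subr_gt0//; lra.
Unshelve. all: by end_near. Qed.

Lemma supports_gt_left h s c : supports h s c -> c < 0 ->
  \forall r \near s^'-, h s < h r.
Proof.
move=> hc c0; have c2 : 0 < - c / 2 by rewrite divr_gt0 ?oppr_gt0.
near=> r; have sr : r < s by near: r; exact: nbhs_left_lt.
have : h s + c * (r - s) - - c / 2 * `|r - s| <= h r.
  by near: r; exact: cvg_within (hc _ c2).
have : 0 < c * (r - s) by rewrite nmulr_rgt0 ?subr_lt0.
by rewrite ltr0_norm ?subr_lt0//; lra.
Unshelve. all: by end_near. Qed.

Lemma supports_tilt h s c k : supports h s c ->
  supports (fun r => h r - k * r) s (c - k).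
Proof.
move=> hc e e0; near=> r.
have : h s + c * (r - s) - e * `|r - s| <= h r by near: r; exact: hc.
lra.
Unshelve. all: by end_near. Qed.

(** At an interior maximum, [c > 0] would force larger values just to the right and [c < 0] just to
    the left. *)
Lemma no_interior_max h a b : a <= b -> {within `[a, b], continuous h} ->
  (forall s, a < s < b -> exists2 c, c != 0 & supports h s c) ->
  forall s, a <= s <= b -> h s <= Num.max (h a) (h b).
Proof.
move=> ab hcont hsup s sab.
have [m + hm] := EVT_max ab hcont.
have {sab} sm : h s <= h m by apply: hm; rewrite in_itv.
rewrite in_itv/= => /andP[am mb]; apply: (le_trans sm); rewrite le_max.
move: am; rewrite le_eqVlt => /predU1P[->|am]; first by rewrite lexx.
move: mb; rewrite le_eqVlt => /predU1P[->|mb]; first by rewrite lexx orbT.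
have /hsup[c c0 hc] : a < m < b by rewrite am mb.
exfalso; have [cn|cp|ce] := ltgtP c 0; last by rewrite ce eqxx in c0.
- near m^'- => r; suff: h r <= h m.
    by apply/negP; rewrite -ltNge; near: r; exact: supports_gt_left hc cn.
  apply: hm; rewrite in_itv/=; apply/andP; split.
    by near: r; exact: nbhs_left_ge.
  by rewrite (le_trans _ (ltW mb))//; near: r; exact: nbhs_left_le.
- near m^'+ => r; suff: h r <= h m.
    by apply/negP; rewrite -ltNge; near: r; exact: supports_gt_right hc cp.
  apply: hm; rewrite in_itv/=; apply/andP; split.
    by rewrite (le_trans (ltW am))//; near: r; exact: nbhs_right_ge.
  by near: r; exact: nbhs_right_le.
Unshelve. all: by end_near. Qed.

Lemma at_right_ex s (P : R -> Prop) : (\forall r \near s^'+, P r) ->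
  exists2 b, s < b & forall r, s < r < b -> P r.
Proof.
move=> /nbhs_ballP[e /= e0 he]; exists (s + e); first by rewrite ltrDl.
move=> r /andP[sr re]; apply: he => //.
by rewrite /ball/= ltr_distlC; apply/andP; split; lra.
Qed.

(** * One-sided slopes cannot jump *)

Section RightSlope.
Variables (S b : R -> R) (t T b0 : R).
Hypothesis tT : t < T.
Hypothesis Scont : {within `[t, T], continuous S}.
Hypothesis Ssup : forall s, t < s < T -> supports S s (b s).
Hypothesis Sright : forall e, 0 < e ->
  \forall r \near t^'+, `|S r - S t - (r - t) * b0| <= e * (r - t).

Let tilt_cont c a a' : t <= a -> a' <= T ->
  {within `[a, a'], continuous (fun r => S r - c * r)}.
Proof.
move=> ta aT; apply: (@continuous_subspaceW _ _ _ `[t, T]).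
  by move=> x /=; rewrite !in_itv/= => xa; lra.
move=> x; apply: cvgB; first exact: Scont.
apply: continuous_subspaceT => y.
by apply: cvgMr; exact: cvg_id.
Qed.

(* A slope above c near t would make S - c r increasing up to a fixed r0 > t, for
   lack of interior maxima, although S(r0) - c r0 < S(t) - c t. *)
Lemma right_slope_lt c : b0 < c -> (\forall s \near t^'+, b s != c) ->
  \forall s \near t^'+, b s < c.
Proof.
move=> bc bne; pose h r := S r - c * r.
have e0 : 0 < (c - b0) / 2 by lra.
have [r1 tr1 hr1] : exists2 r1, t < r1 & forall r, t < r < r1 ->
    [/\ b r != c, h r < h t & r < T].
  apply: at_right_ex; near=> r; have tr : t < r by near: r; exact: nbhs_right_gt.
  split; [by near: r| |by near: r; exact: nbhs_right_lt].
  have : `|S r - S t - (r - t) * b0| <= (c - b0) / 2 * (r - t).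
    by near: r; exact: Sright.
  have : 0 < (c - b0) * (r - t) by rewrite mulr_gt0//; lra.
  by rewrite ler_norml /h; lra.
pose r0 := (t + r1) / 2.
have r0r1 : t < r0 < r1 by rewrite /r0; lra.
have [_ hr0 r0T] := hr1 _ r0r1.
near=> s; have ts : t < s by near: s; exact: nbhs_right_gt.
have sr0 : s < r0 by near: s; apply: nbhs_right_lt; lra.
(* The expansion at [t] with error rate 1 gives [h s >= h t - (c - b0 + 1) * (s - t)], so for [s]
   close to [t] the function has not yet dropped to [h r0 < h t]. *)
have hs : h r0 < h s.
  have h1 : `|S s - S t - (s - t) * b0| <= 1 * (s - t) by near: s; exact: Sright.
  have M0 : 0 < c - b0 + 1 by lra.
  have : s - t < (h t - h r0) / (c - b0 + 1).
    by near: s; apply: nbhs_right_ltDr; rewrite divr_gt0//; lra.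
  rewrite ltr_pdivlMr//; move: h1; rewrite ler_norml /h; lra.
have [bs _ sT] : [/\ b s != c, h s < h t & s < T] by apply: hr1; lra.
rewrite ltNge; apply/negP; rewrite le_eqVlt eq_sym (negbTE bs)/= => cb.
have hgt : \forall r \near s^'+, h s < h r.
  apply: (@supports_gt_right h s (b s - c)); last lra.
  by apply: supports_tilt; apply: Ssup; lra.
near s^'+ => r.
have sr : s < r by near: r; exact: nbhs_right_gt.
have rr0 : r < r0 by near: r; exact: nbhs_right_lt.
have hsr : h s < h r by near: r; exact: hgt.
have : h r <= Num.max (h s) (h r0).
  apply: (@no_interior_max h s r0); rewrite ?(ltW sr0) ?(ltW sr) ?(ltW rr0)//.
    by apply: tilt_cont; exact: ltW.
  move=> x xs; exists (b x - c); last by apply: supports_tilt; apply: Ssup; lra.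
  by rewrite subr_eq0; have [] : [/\ b x != c, h x < h t & x < T] by apply: hr1; lra.
by rewrite le_max leNgt hsr/= leNgt (lt_trans hs hsr).
Unshelve. all: by end_near. Qed.

(** A slope below [c] at [s] would make [S r - c * r] larger just before [s] than at [s], where it
    already exceeds its value at [t]; this contradicts the absence of interior maxima on
    [[t, s]]. *)
Lemma right_slope_gt c : c < b0 -> (\forall s \near t^'+, b s != c) ->
  \forall s \near t^'+, c < b s.
Proof.
move=> bc bne; pose h r := S r - c * r.
have e0 : 0 < (b0 - c) / 2 by lra.
have [r1 tr1 hr1] : exists2 r1, t < r1 & forall r, t < r < r1 ->
    [/\ b r != c, h t < h r & r < T].
  apply: at_right_ex; near=> r; have tr : t < r by near: r; exact: nbhs_right_gt.
  split; [by near: r| |by near: r; exact: nbhs_right_lt].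
  have : `|S r - S t - (r - t) * b0| <= (b0 - c) / 2 * (r - t).
    by near: r; exact: Sright.
  have : 0 < (b0 - c) * (r - t) by rewrite mulr_gt0//; lra.
  by rewrite ler_norml /h; lra.
near=> s; have ts : t < s by near: s; exact: nbhs_right_gt.
have sr1 : s < r1 by near: s; exact: nbhs_right_lt.
have [bs hs sT] : [/\ b s != c, h t < h s & s < T] by apply: hr1; lra.
rewrite ltNge; apply/negP; rewrite le_eqVlt (negbTE bs)/= => cb.
have hgt : \forall r \near s^'-, h s < h r.
  apply: (@supports_gt_left h s (b s - c)); last lra.
  by apply: supports_tilt; apply: Ssup; lra.
near s^'- => r.
have sr : r < s by near: r; exact: nbhs_left_lt.
have rr0 : t < r by near: r; exact: nbhs_left_gt.
have hsr : h s < h r by near: r; exact: hgt.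
have : h r <= Num.max (h t) (h s).
  apply: (@no_interior_max h t s); rewrite ?(ltW ts) ?(ltW rr0) ?(ltW sr)//.
    by apply: tilt_cont => //; exact: ltW.
  move=> x xs; exists (b x - c); last by apply: supports_tilt; apply: Ssup; lra.
  by rewrite subr_eq0; have [] : [/\ b x != c, h t < h x & x < T] by apply: hr1; lra.
by rewrite le_max; lra.
Unshelve. all: by end_near. Qed.

End RightSlope.

End Supports.

(** * Real branches of one variable *)

(** Just to the right of [a], [c] lies beyond every value at most [a] and before every other
    value. *)
Lemma avoid_finite (R : realType) (I : finType) (v : I -> R) (a b : R) :
  a < b -> exists2 c, a < c < b &
             exists2 g, 0 < g & forall i, g <= `|v i - c|.
Proof.
move=> ab; near a^'+ => c.
have ac : a < c by near: c; exact: nbhs_right_gt.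
have cb : c < b by near: c; exact: nbhs_right_lt.
have vc : forall i, v i != c.
  near: c; apply: filter_forall => i; have [vi|vi] := leP (v i) a.
    by near=> c; rewrite lt_eqF// (le_lt_trans vi)//; near: c; exact: nbhs_right_gt.
  by near=> c; rewrite gt_eqF//; near: c; exact: nbhs_right_lt.
exists c; first by rewrite ac.
near (0 : R)^'+ => g; exists g; first by near: g; exact: nbhs_right_gt.
near: g; apply: filter_forall => i; apply: nbhs_right_le.
by rewrite normr_gt0 subr_eq0.
Unshelve. all: by end_near. Qed.

Section Branches.
Variables (R : realType) (q : nat).
Implicit Types (z u : R -> 'I_q -> R) (t s r e d c : R).

(** Differentiability of an unordered tuple: the permutation depends on [s], so a fixed index need
    not follow a continuous curve. Value and velocity at the same time do share their index. *)
Definition branch_diff z u := forall t, 0 <= t <= 1 -> forall e, 0 < e ->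
  \forall s \near t, 0 <= s <= 1 -> exists p : 'S_q,
    forall i, `|z s (p i) - z t i - (s - t) * u t i| <= e * `|s - t|.

Definition branch_vel u := forall t, 0 <= t <= 1 -> forall e, 0 < e ->
  \forall s \near t, 0 <= s <= 1 -> exists p : 'S_q,
    forall i, `|u s (p i) - u t i| <= e.

Lemma top_sum_affine k (x y : 'I_q -> R) h :
  top_sum k (fun i => x i + h * y i) = top_sum k x + h * top_sum k y.
Proof. by rewrite /top_sum big_split mulr_sumr. Qed.

(** * Branches sorted by value, with ties broken by velocity *)

Section Sorted.
Variables z u : R -> 'I_q -> R.
Hypothesis zdiff : branch_diff z u.
Hypothesis uvel : branch_vel u.
Hypothesis z_antitone : forall t, antitone (z t).
Hypothesis u_antitone : forall t (i j : 'I_q),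
  (i <= j)%N -> z t i = z t j -> u t j <= u t i.

Let q1 : 0 < q%:R + 1 :> R.
Proof. by rewrite ltr_wpDl. Qed.

(** The first-order predictions are matched with the entries of [z r], and no sum of [k] of those
    exceeds the top sum. Only the order at [r] enters, so the bound holds on both sides of [s]. *)
Lemma top_sum_supports k s : 0 < s < 1 ->
  supports (fun r => top_sum k (z r)) s (top_sum k (u s)).
Proof.
move=> /andP[s0 s1] e e0; have e1 : 0 < e / (q%:R + 1) by rewrite divr_gt0.
near=> r.
have [|p hp] : 0 <= r <= 1 -> exists p : 'S_q, forall i,
    `|z r (p i) - z s i - (r - s) * u s i| <= e / (q%:R + 1) * `|r - s|.
  by near: r; apply: zdiff => //; rewrite !ltW.
  have r0 : 0 < r by near: r; exact: lt_nbhsr.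
  have r1 : r < 1 by near: r; exact: lt_nbhsl.
  by rewrite !ltW.
have := @top_sum_shift _ _ (fun i => z s i + (r - s) * u s i) (z r) p^-1%g
  (e / (q%:R + 1) * `|r - s|) k (z_antitone r).
rewrite mulr_ge0// ?(ltW e1)// => /(_ isT).
rewrite top_sum_affine => h; rewrite mulrC lerBlDr.
apply: (le_trans (h _)) => [i|].
  by move: (hp (p^-1%g i)); rewrite permKV ler_norml; lra.
rewrite lerD2l mulrA ler_wpM2r// mulrCA ger_pMr// ler_pdivrMr// mul1r.
by rewrite lerDl.
Unshelve. all: by end_near. Qed.

Lemma top_sum_continuous k t : 0 <= t <= 1 ->
  {within `[t, 1], continuous (fun r => top_sum k (z r))}.
Proof.
move=> /andP[t0 t1]; apply/subspace_continuousP => s /=.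
rewrite in_itv/= => /andP[ts s1]; apply/cvgrPdist_le => e e0.
(* A bound for the rate of change: [M - 1] for the velocities and 1 for the remainder. *)
pose M : R := \sum_i `|u s i| + 1.
have M0 : 0 < M by rewrite ltr_wpDl// sumr_ge0.
have uM i : `|u s i| <= M - 1.
  by rewrite addrK (bigD1 i)//= lerDl sumr_ge0.
rewrite near_withinE; near=> r; move=> rt; rewrite /from_subspace/=.
have [|p hp] : 0 <= r <= 1 -> exists p : 'S_q, forall i,
    `|z r (p i) - z s i - (r - s) * u s i| <= 1 * `|r - s|.
  by near: r; apply: zdiff => //; rewrite (le_trans t0 ts).
  by move: rt; rewrite /= in_itv/= => /andP[tr ->]; rewrite (le_trans t0).
have zrs i : `|z r (p i) - z s i| <= M * `|r - s|.
  have : `|(r - s) * u s i| <= (M - 1) * `|r - s|.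
    by rewrite normrM mulrC ler_wpM2r.
  by move: (hp i); rewrite !ler_norml; lra.
have e1 : q%:R * (M * `|r - s|) <= e.
  have -> : q%:R * (M * `|r - s|) = `|s - r| * (q%:R * M) by rewrite distrC; ring.
  apply: (@le_trans _ _ (`|s - r| * ((q%:R + 1) * M))).
    by rewrite ler_wpM2l// ler_wpM2r ?(ltW M0)// lerDl.
  rewrite -ler_pdivlMr ?mulr_gt0//.
  near: r; apply/nbhs_ballP; exists (e / ((q%:R + 1) * M)) => /=.
    by rewrite divr_gt0// mulr_gt0.
  by move=> r /= /ltW; rewrite distrC.
have h1 : top_sum k (z r) <= top_sum k (z s) + q%:R * (M * `|r - s|).
  apply: (@top_sum_shift _ _ _ _ p) => //; first by rewrite mulr_ge0// ltW.
  by move=> i; move: (zrs i); rewrite ler_norml; lra.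
have h2 : top_sum k (z s) <= top_sum k (z r) + q%:R * (M * `|r - s|).
  apply: (@top_sum_shift _ _ _ _ p^-1%g) => //; first by rewrite mulr_ge0// ltW.
  by move=> i; move: (zrs (p^-1%g i)); rewrite permKV ler_norml; lra.
by rewrite ler_norml; lra.
Unshelve. all: by end_near. Qed.

(** Shortly after [t] the linear predictions are still sorted: distinct values keep their order and
    equal ones are ordered by velocity. Both tuples being antitone, [antitone_match] replaces the
    unknown permutation by the identity, and the factor [2 * (q%:R + 1)] pays for its loss. *)
Lemma sorted_right t : 0 <= t < 1 -> forall e, 0 < e -> \forall s \near t^'+,
  forall i, `|z s i - z t i - (s - t) * u t i| <= e * (s - t).
Proof.
move=> /andP[t0 t1] e e0.
have e1 : 0 < e / (2 * (q%:R + 1)) by rewrite divr_gt0// mulr_gt0.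
have yanti0 : \forall s \near t^'+, forall i j : 'I_q, (i <= j)%N ->
    z t j + (s - t) * u t j <= z t i + (s - t) * u t i.
  apply: filter_forall => i; apply: filter_forall => j.
  have [ij|ji] := leqP i j; last by near=> s.
  have a0 : 0 < `|u t i| + `|u t j| + 1 by rewrite ltr_wpDl// addr_ge0.
  have := z_antitone t ij; rewrite le_eqVlt => /predU1P[zij|zij].
    near=> s; rewrite zij lerD2l ler_wpM2l ?u_antitone// subr_ge0.
    by near: s; exact: nbhs_right_ge.
  have d0 : 0 < z t i - z t j by rewrite subr_gt0.
  near=> s => _; have ts' : t < s by near: s; exact: nbhs_right_gt.
  have : s - t < (z t i - z t j) / (`|u t i| + `|u t j| + 1).
    by near: s; apply: nbhs_right_ltDr; exact: divr_gt0.
  rewrite ltr_pdivlMr// => hs.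
  have : `|(s - t) * u t i| <= (s - t) * `|u t i|.
    by rewrite normrM gtr0_norm ?subr_gt0.
  have : `|(s - t) * u t j| <= (s - t) * `|u t j|.
    by rewrite normrM gtr0_norm ?subr_gt0.
  by rewrite !ler_norml; lra.
near=> s; have ts : t < s by near: s; exact: nbhs_right_gt.
have [|p hp] : 0 <= s <= 1 -> exists p : 'S_q, forall i,
    `|z s (p i) - z t i - (s - t) * u t i| <= e / (2 * (q%:R + 1)) * `|s - t|.
  near: s; apply: (@cvg_within _ (nbhs t)).
  by apply: zdiff => //; rewrite t0 ltW.
  by rewrite (le_trans t0 (ltW ts))/=; near: s; exact: nbhs_right_le.
rewrite gtr0_norm ?subr_gt0// in hp *.
have yanti : antitone (fun i => z t i + (s - t) * u t i) by near: s.
move=> i; rewrite -addrA -opprD.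
apply: le_trans (antitone_match (z_antitone s) yanti _ (p := p)
   (e := e / (2 * (q%:R + 1)) * (s - t)) _ i) _.
- by rewrite mulr_ge0 ?(ltW e1)// subr_ge0 ltW.
- by move=> j; move: (hp j); rewrite opprD addrA.
rewrite !mulrA ler_wpM2r ?subr_ge0 ?(ltW ts)//.
rewrite ler_pdivrMr ?mulr_gt0// mulrC ler_wpM2l ?(ltW e0)//.
by rewrite ler_wpM2l// lerDl.
Unshelve. all: by end_near. Qed.

(** Matching velocities at [s] with those at [t] puts every top sum at [s] at distance less than [g]
    from a subset sum at [t], namely over the indices that [p] sends below [k]. *)
Lemma subset_sum_avoid t c : 0 <= t < 1 ->
  (exists2 g, 0 < g & forall A : {set 'I_q}, g <= `|\sum_(i in A) u t i - c|) ->
  forall k, \forall s \near t^'+, top_sum k (u s) != c.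
Proof.
move=> /andP[t0 t1] [g g0 hg] k.
have e1 : 0 < g / (q%:R + 1) by rewrite divr_gt0.
near=> s; have ts : t < s by near: s; exact: nbhs_right_gt.
have [|p hp] : 0 <= s <= 1 -> exists p : 'S_q, forall i,
    `|u s (p i) - u t i| <= g / (q%:R + 1).
  near: s; apply: (@cvg_within _ (nbhs t)).
  by apply: uvel => //; rewrite t0 ltW.
  by rewrite (le_trans t0 (ltW ts))/=; near: s; exact: nbhs_right_le.
apply/eqP => sc; have := hg [set i | (p i < k)%N]%SET.
have Es : top_sum k (u s) = \sum_(i | (p i < k)%N) u s (p i).
  by rewrite /top_sum (reindex_inj (@perm_inj _ p)).
apply/negP; rewrite -ltNge -sc Es.
rewrite (eq_bigl (fun i => (p i < k)%N)); last by move=> i; rewrite inE.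
rewrite distrC -sumrB; apply: (le_lt_trans (ler_norm_sum _ _ _)).
apply: (@le_lt_trans _ _ (\sum_(i < q) g / (q%:R + 1))).
  rewrite big_mkcond/=; apply: ler_sum => i _; case: ifP => _ //.
  exact: ltW.
rewrite sumr_const card_ord -[ltLHS]mulr_natl mulrCA gtr_pMr//.
by rewrite ltr_pdivrMr// mul1r ltrDl.
Unshelve. all: by end_near. Qed.

(** Around each top sum of velocities at [t], choose [c2] below and [c1] above, within [e / 2] and
    away from all subset sums. The slopes at later times can reach neither, so they stay between
    them. *)
Lemma sorted_right_vel t : 0 <= t < 1 -> forall e, 0 < e ->
  \forall s \near t^'+, forall i, `|u s i - u t i| <= e.
Proof.
move=> t01 e e0; have /andP[t0 t1] := t01.
have slopes k : \forall s \near t^'+,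
    `|top_sum k (u s) - top_sum k (u t)| <= e / 2.
  have Sr d : 0 < d -> \forall r \near t^'+,
      `|top_sum k (z r) - top_sum k (z t) - (r - t) * top_sum k (u t)|
        <= d * (r - t).
    move=> d0; have d1 : 0 < d / (q%:R + 1) by rewrite divr_gt0.
    near=> r; have tr : t < r by near: r; exact: nbhs_right_gt.
    have hr : forall i, `|z r i - z t i - (r - t) * u t i|
        <= d / (q%:R + 1) * (r - t) by near: r; exact: sorted_right.
    rewrite /top_sum mulr_sumr -!sumrB; apply: (le_trans (ler_norm_sum _ _ _)).
    apply: (@le_trans _ _ (\sum_(i < q) d / (q%:R + 1) * (r - t))).
      rewrite big_mkcond/=; apply: ler_sum => i _; case: ifP => _ //.
      by rewrite mulr_ge0 ?(ltW d1)// subr_ge0 ltW.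
    rewrite sumr_const card_ord -[leLHS]mulr_natl mulrA ler_wpM2r//.
      by rewrite subr_ge0 ltW.
    by rewrite mulrCA ger_pMr// ler_pdivrMr// mul1r lerDl.
  have sup s : t < s < 1 ->
      supports (fun r => top_sum k (z r)) s (top_sum k (u s)).
    by move=> /andP[ts s1]; apply: top_sum_supports; rewrite (le_lt_trans t0 ts).
  have cont : {within `[t, 1], continuous (fun r => top_sum k (z r))}.
    by apply: top_sum_continuous; rewrite t0 ltW.
  pose v (A : {set 'I_q}) := \sum_(i in A) u t i.
  have [c1 c1b g1] : exists2 c, top_sum k (u t) < c < top_sum k (u t) + e / 2 &
      exists2 g, 0 < g & forall A, g <= `|v A - c|.
    by apply: avoid_finite; rewrite ltrDl divr_gt0.
  have [c2 c2b g2] : exists2 c, top_sum k (u t) - e / 2 < c < top_sum k (u t) &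
      exists2 g, 0 < g & forall A, g <= `|v A - c|.
    by apply: avoid_finite; rewrite gtrDl oppr_lt0 divr_gt0.
  near=> s.
  have h1 : top_sum k (u s) < c1.
    near: s; apply: (right_slope_lt t1 cont sup Sr); first by case/andP: c1b.
    exact: subset_sum_avoid.
  have h2 : c2 < top_sum k (u s).
    near: s; apply: (right_slope_gt t1 cont sup Sr); first by case/andP: c2b.
    exact: subset_sum_avoid.
  by rewrite ler_norml; lra.
near=> s => i; rewrite -[e](@divfK _ 2)// mulrC.
apply: top_sum_coord => k kq.
suff H : forall k : 'I_q.+1, `|top_sum k (u s) - top_sum k (u t)| <= e / 2.
  by have := H (Ordinal (kq : (k < q.+1)%N)).
by near: s; apply: filter_forall => k'; exact: slopes.
Unshelve. all: by end_near. Qed.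

End Sorted.
End Branches.

(** * Unsorted branches followed forwards and backwards in time *)

Section Transport.
Variables (R : realType) (q : nat) (z u : R -> 'I_q -> R).
Hypothesis zdiff : branch_diff z u.
Hypothesis uvel : branch_vel u.
Implicit Types (t s r e d c : R).

(** The gain over the hypotheses is that one permutation serves values and velocities at once.
    Sorting at each time reduces to the identity permutation, and undoing the sorts gives [p]. *)
Lemma branches_right t : 0 <= t < 1 -> forall e, 0 < e ->
  \forall s \near t^'+, exists p : 'S_q, forall i,
    `|z s (p i) - z t i - (s - t) * u t i| <= e * (s - t) /\
    `|u s (p i) - u t i| <= e.
Proof.
move=> t01 e e0.
pose zu s i : (R *l R)%type := (z s i, u s i).
have /choice[g hg] s : exists g : 'S_q, forall i j : 'I_q, (i <= j)%N ->
    (zu s (g j) <= zu s (g i))%O.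
  exact: sorting_perm.
pose Z s i := z s (g s i); pose U s i := u s (g s i).
have Zdiff : branch_diff Z U.
  move=> s s01 d d0; near=> r; move=> r01.
  have [|p hp] : 0 <= r <= 1 -> exists p : 'S_q, forall i,
      `|z r (p i) - z s i - (r - s) * u s i| <= d * `|r - s|.
    by near: r; exact: zdiff.
    by [].
  by exists (g s * p * (g r)^-1)%g => i; rewrite /Z /U !permM permKV.
have Uvel : branch_vel U.
  move=> s s01 d d0; near=> r; move=> r01.
  have [|p hp] : 0 <= r <= 1 -> exists p : 'S_q, forall i,
      `|u r (p i) - u s i| <= d.
    by near: r; exact: uvel.
    by [].
  by exists (g s * p * (g r)^-1)%g => i; rewrite /U !permM permKV.
have Zanti s : antitone (Z s).
  by move=> i j ij; have := hg s i j ij; rewrite /zu lexi_pair => /andP[].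
have Uanti s (i j : 'I_q) : (i <= j)%N -> Z s i = Z s j -> U s j <= U s i.
  move=> ij zij; have := hg s i j ij; rewrite /zu lexi_pair => /andP[_].
  by move: zij; rewrite /Z => ->; rewrite lexx.
near=> s; exists ((g t)^-1 * g s)%g => i; rewrite permM.
split.
  have H : forall i, `|Z s i - Z t i - (s - t) * U t i| <= e * (s - t).
    by near: s; exact: (sorted_right Zdiff).
  by have := H ((g t)^-1%g i); rewrite /Z /U permKV.
have H : forall i, `|U s i - U t i| <= e.
  by near: s; exact: (sorted_right_vel Zdiff).
by have := H ((g t)^-1%g i); rewrite /U permKV.
Unshelve. all: by end_near. Qed.

End Transport.

Section Reflection.
Variables (R : realType) (q : nat) (z u : R -> 'I_q -> R).
Hypothesis zdiff : branch_diff z u.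
Hypothesis uvel : branch_vel u.
Implicit Types (t s r e d c : R).

Let near_reflect t (P : R -> Prop) :
  (\forall s \near 1 - t, P s) -> \forall s \near t, P (1 - s).
Proof.
move=> /nbhs_ballP[d /= d0 hd]; apply/nbhs_ballP; exists d => // s /= ts.
apply: hd; move: ts; rewrite /ball/= distrC.
by congr (`|_| < _); ring.
Qed.

(** Time reversal [s -> 1 - s], which changes the sign of velocities. *)
Lemma branches_left t : 0 < t <= 1 -> forall e, 0 < e ->
  \forall s \near t^'-, exists p : 'S_q, forall i,
    `|z s (p i) - z t i - (s - t) * u t i| <= e * (t - s) /\
    `|u s (p i) - u t i| <= e.
Proof.
move=> t01 e e0.
pose Z s := z (1 - s); pose U s i := - u (1 - s) i.
have Zdiff : branch_diff Z U.
  move=> s s01 d d0.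
  have s01' : 0 <= 1 - s <= 1 by lra.
  have := near_reflect (zdiff s01' d0); apply: filterS => r hr r01.
  have [|p hp] := hr; first by lra.
  exists p => i; rewrite /Z /U; have := hp i.
  have -> : 1 - r - (1 - s) = - (r - s) by ring.
  by rewrite normrN mulNr mulrN.
have Uvel : branch_vel U.
  move=> s s01 d d0.
  have s01' : 0 <= 1 - s <= 1 by lra.
  have := near_reflect (uvel s01' d0); apply: filterS => r hr r01.
  have [|p hp] := hr; first by lra.
  by exists p => i; rewrite /U -opprD normrN.
have t01' : 0 <= 1 - t < 1 by lra.
have [b tb hb] := at_right_ex (branches_right Zdiff Uvel t01' e0).
near=> s.
have [|p hp] := hb (1 - s).
  have : s < t by near: s; exact: nbhs_left_lt.
  have : 1 - b < s by near: s; apply: nbhs_left_gt; lra.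
  lra.
exists p => i; have [] := hp i; rewrite /Z /U !subKr -opprD normrN.
have -> : 1 - s - (1 - t) = t - s by ring.
have -> : (t - s) * - u t i = (s - t) * u t i by ring.
by [].
Unshelve. all: by end_near. Qed.

End Reflection.

(** A path without repetitions has fewer than [q] edges, each of length at most [e]. *)
Lemma connect_dist (R : realType) (q : nat) (w : 'I_q -> R) (e : R) :
  0 <= e -> forall i j, connect (fun i j => `|w i - w j| <= e) i j ->
  `|w i - w j| <= q%:R * e.
Proof.
move=> e0 i j /connectP[p0 pp0 ->]; case/shortenP: pp0 => p pp up _.
apply: (@le_trans _ _ ((size p)%:R * e)); last first.
  rewrite ler_wpM2r// ler_nat ltnW//.
  by have := max_card (mem (i :: p)); rewrite card_ord (card_uniqP up).
elim: p i pp {up} => [|k p IH] i /=; first by rewrite subrr normr0 mul0r.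
move=> /andP[ik /IH]; have := ler_distD (w k) (w i) (w (last k p)).
by rewrite -[(size p).+1]add1n natrD mulrDl mul1r; lra.
Qed.

(** * Mean value inequality for real branches *)

Section MeanValue.
Variables (R : realType) (q : nat) (z u : R -> 'I_q -> R) (e : R).
Hypothesis zdiff : branch_diff z u.
Hypothesis uvel : branch_vel u.
Hypothesis e0 : 0 < e.
Hypothesis uclose : forall t, 0 <= t <= 1 ->
  exists p : 'S_q, forall i, `|u t (p i) - u 0 i| <= e.
Implicit Types (t s r : R).

Let w := u 0.
(* Velocities within e of one of the values w vary by at most e in a small step,
   so they cannot leave a connected component of adj. *)
Let adj := fun i j : 'I_q => `|w i - w j| <= 3 * e.
(** The term [q%:R * (3 * e)] bounds the width of a component; one [e] is the distance of a velocity
    from it, the other the linearisation error of a step. *)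
Let C : R := q%:R * (3 * e) + 2 * e.

Let transported t (p : 'S_q) := forall i,
  `|z t (p i) - z 0 i - t * w i| <= C * t /\
  exists2 j, connect adj i j & `|u t (p i) - w j| <= e.

Let near_w t k : 0 <= t <= 1 -> exists j, `|u t k - w j| <= e.
Proof.
move=> /uclose[p hp]; exists (p^-1%g k).
by have := hp (p^-1%g k); rewrite permKV.
Qed.

(** The velocity [v] may be taken at either end, so that the step covers expansions at its start and
    at its end. *)
Let step s t (v : 'I_q -> R) (p p' : 'S_q) :
  0 <= s <= 1 -> 0 <= t <= 1 -> s <= t -> transported s p ->
  (forall k, [/\ `|z t (p' k) - z s k - (t - s) * v k| <= e * (t - s),
     `|u t (p' k) - u s k| <= e & v k = u s k \/ v k = u t (p' k)]) ->
  transported t (p * p')%g.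
Proof.
move=> s01 t01 st hs hp' i; rewrite permM.
have [zs [j ij uj]] := hs i; have [zt ut vk] := hp' (p i).
have [j' uj'] := near_w (p' (p i)) t01.
have ij' : connect adj i j'.
  apply: (connect_trans ij); apply: connect1; rewrite /adj.
  by move: uj uj' ut; rewrite !ler_norml; lra.
split; last by exists j'.
have e3 : 0 <= 3 * e by rewrite mulr_ge0// ltW.
have := connect_dist e3 ij; have := connect_dist e3 ij' => hj' hj.
have vw : `|v (p i) - w i| <= C - e.
  move: uj uj' hj hj'; rewrite /C !ler_norml.
  by case: vk => ->; lra.
have : `|(t - s) * (v (p i) - w i)| <= (t - s) * (C - e).
  by rewrite normrM ger0_norm ?ler_wpM2l ?subr_ge0.
by move: zs zt; rewrite !ler_norml; lra.
Qed.

Lemma branches_mean_value : exists p : 'S_q, forall i,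
  `|z 1 (p i) - z 0 i - u 0 i| <= q%:R * (3 * e) + 2 * e.
Proof.
(* Continuous induction: the supremum [T] belongs to [E] by the expansion to the left of [T], and
   [T < 1] is refuted by the expansion to its right. *)
pose E : set R := [set t | 0 <= t <= 1 /\ exists p, transported t p].
have E0 : E 0.
  split; first by rewrite lexx ler01.
  exists 1%g => i; rewrite perm1 mul0r subr0 subrr normr0 mulr0; split=> //.
  by exists i => //; rewrite subrr normr0 ltW.
have Esup : has_sup E by split; [exists 0|exists 1 => t [/andP[]]].
pose T := sup E.
have T0 : 0 <= T by apply: ub_le_sup => //; case: Esup.
have T1 : T <= 1 by apply: ge_sup; [case: Esup|move=> t [/andP[]]].
have T01 : 0 <= T <= 1 by rewrite T0.
have [p hp] : exists p, transported T p.
  have [T_eq0|T_gt0] := leP T 0.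
    have -> : T = 0 by apply/eqP; rewrite eq_le T_eq0.
    by case: E0.
  have T01' : 0 < T <= 1 by rewrite T_gt0.
  have /nbhs_ballP[d /= d0 hd] := branches_left zdiff uvel T01' e0.
  have [s [s01 [p hs]] sT] := sup_adherent d0 Esup.
  have := ub_le_sup (proj2 Esup) (conj s01 (ex_intro _ p hs) : E s).
  rewrite -/T le_eqVlt => /predU1P[sT'|sT']; first by exists p; rewrite -sT'.
  have [||p' hp'] := hd s.
    by rewrite /ball/= gtr0_norm ?subr_gt0// ltrBlDl -ltrBlDr.
    by [].
  (* The expansion at [T] leads from [T] back to [s]; its inverse carries [s] to [T], with the
     velocity read at [T]. *)
  exists (p * p'^-1)%g.
  apply: (@step s T (fun k => u T (p'^-1%g k)) p p'^-1%g s01 T01 (ltW sT') hs).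
  move=> k; have [] := hp' (p'^-1%g k); rewrite permKV => h1 h2; split.
  - by move: h1; rewrite !ler_norml; lra.
  - by rewrite distrC.
  - by right.
move: T1; rewrite le_eqVlt => /predU1P[T1|T1].
  by exists p => i; have [+ _] := hp i; rewrite T1 mulr1 mul1r.
have T01' : 0 <= T < 1 by rewrite T0.
near T^'+ => s; exfalso.
have Ts : T < s by near: s; exact: nbhs_right_gt.
have s1 : s <= 1 by near: s; exact: nbhs_right_le.
have s01 : 0 <= s <= 1 by rewrite (le_trans T0 (ltW Ts)).
have [p' hp'] : exists p' : 'S_q, forall i,
    `|z s (p' i) - z T i - (s - T) * u T i| <= e * (s - T) /\
    `|u s (p' i) - u T i| <= e.
  by near: s; exact: branches_right.
have Es : E s.
  split=> //; exists (p * p')%g; apply: (@step T s (u T) p p' T01 s01 (ltW Ts) hp).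
  by move=> k; have [] := hp' k; split=> //; left.
by have := ub_le_sup (proj2 Esup) Es; rewrite leNgt Ts.
Unshelve. all: by end_near. Qed.

End MeanValue.

(** * Matching polynomials at many nodes *)

Lemma pigeonhole_injection (T : finType) (M d : nat) (c : 'I_M -> T) :
  (#|T| * d < M)%N ->
  exists tau, exists2 h : {ffun 'I_d -> 'I_M}, injective h &
    forall l, c (h l) = tau.
Proof.
move=> TdM.
have [tau htau] : exists tau, (d <= #|[pred k | c k == tau]|)%N.
  apply: contrapT => /forallNP few; move: TdM; rewrite ltnNge => /negP; apply.
  rewrite -[M in (M <= _)%N]card_ord -sum1_card.
  rewrite (partition_big c xpredT)//= -sum_nat_const; apply: leq_sum => tau _.
  rewrite sum1_card ltnW// ltnNge; apply/negP.
  by have := few tau; congr (~ is_true (_ <= _)%N); apply: eq_card => k.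
exists tau; exists [ffun l => enum_val (widen_ord htau l)].
  move=> l l'; rewrite !ffunE => /enum_val_inj/(congr1 val)/= ll'.
  exact/val_inj.
by move=> l; rewrite ffunE; have := enum_valP (widen_ord htau l); rewrite inE => /eqP.
Qed.

Section Nodes.
Variables (R : realType) (d : nat).

Definition node_mx (t : 'I_d -> R) := Vandermonde d (\row_l t l).

(** Weights that recover the coefficient of degree [j] from the values at the nodes. *)
Definition interp (t : 'I_d -> R) (j l : 'I_d) : R := invmx (node_mx t) l j.

Lemma interpE (W : lmodType R) (t : 'I_d -> R) (w : 'I_d -> W) j :
  injective t ->
  \sum_l interp t j l *: (\sum_(i < d) t l ^+ i *: w i) = w j.
Proof.
move=> tI.
have Vu : node_mx t \in unitmx.
  rewrite unitmxE det_Vandermonde unitfE; apply/prodf_neq0 => i _.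
  apply/prodf_neq0 => k ik; rewrite !mxE subr_eq0 (inj_eq tI).
  by rewrite gt_eqF.
under eq_bigr do rewrite scaler_sumr.
rewrite exchange_big/= (bigD1 j)//= [X in _ + X]big1 ?addr0 => [|i ij].
  have := congr1 (fun A : matrix R d d => A j j) (mulmxV Vu); rewrite !mxE eqxx mulr1n => E.
  rewrite -[RHS]scale1r -[in RHS]E scaler_suml. apply: eq_bigr => l _.
  by rewrite scalerA !mxE mulrC.
have := congr1 (fun A : matrix R d d => A i j) (mulmxV Vu); rewrite !mxE (negbTE ij) mulr0n => E.
rewrite -[RHS](scale0r (w i)) -[in RHS]E scaler_suml; apply: eq_bigr => l _.
by rewrite scalerA !mxE mulrC.
Qed.

(** The permutation may change with the node, but among [q! * d + 1] nodes one permutation serves at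
    [d] of them, where interpolation recovers every coefficient. *)
Lemma node_match (q : nat) (t : 'I_(q`! * d).+1 -> R) : injective t ->
  exists2 C, 0 <= C & forall (W : normedModType R) (w w' : 'I_q -> 'I_d -> W) e,
    (forall k, exists p : 'S_q, forall i,
       `|\sum_(j < d) t k ^+ j *: (w i j - w' (p i) j)| <= e) ->
    exists p : 'S_q, forall i j, `|w i j - w' (p i) j| <= C * e.
Proof.
move=> tI.
pose c (h : {ffun 'I_d -> 'I_(q`! * d).+1}) j l := `|interp (t \o h) j l|.
(* Summing over all selections [h] makes [C] depend on the nodes alone. Where the selected nodes
   coincide [invmx] takes a default value, harmless under the absolute value. *)
pose C := \sum_h \sum_j \sum_l c h j l.
exists C; first by do 3 (apply: sumr_ge0 => ? _); exact: normr_ge0.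
move=> W w w' e /choice[p hp].
have [|tau [h hI htau]] := @pigeonhole_injection 'S_q _ d p.
  by rewrite card_Sn.
exists tau => i j.
have e0 : 0 <= e by exact: le_trans (hp ord0 i).
rewrite -(interpE (fun j => w i j - w' (tau i) j) j (inj_comp tI hI)).
apply: (le_trans (ler_norm_sum _ _ _)).
apply: (@le_trans _ _ ((\sum_l c h j l) * e)).
  rewrite mulr_suml; apply: ler_sum => l _; rewrite normrZ ler_wpM2l//.
  by have := hp (h l) i; rewrite htau.
rewrite ler_wpM2r//; apply: (@le_trans _ _ (\sum_j \sum_l c h j l)).
  rewrite [leRHS](bigD1 j)//= lerDl.
  by do 2 (apply: sumr_ge0 => ? _); exact: normr_ge0.
rewrite /C [leRHS](bigD1 h)//= lerDl.
by do 3 (apply: sumr_ge0 => ? _); exact: normr_ge0.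
Qed.

End Nodes.

(** * Tuples of affine maps *)

Section Tuples.
Variables (R : realType) (q : nat) (W : normedModType R).
Implicit Types y z : 'I_q -> W.

Lemma mdist_dsum_match y z e : mdist (dsum y) (dsum z) <= e ->
  exists p : 'S_q, forall i, `|y i - z (p i)| <= e.
Proof.
rewrite Qspace_mdistE Qdist_dsum; have [p ->] := matching_dist_attained y z.
move=> ye; exists p => i; apply: le_trans ye.
by rewrite /matching_cost (bigD1 i)//= lerDl sumr_ge0.
Qed.

Lemma match_mdist_dsum y z (p : 'S_q) e :
  (forall i, `|y i - z (p i)| <= e) -> mdist (dsum y) (dsum z) <= q%:R * e.
Proof.
move=> yz; rewrite Qspace_mdistE Qdist_dsum.
apply: (le_trans (matching_dist_le y z p)).
by rewrite -[q in leRHS]card_ord mulr_natl -sumr_const; apply: ler_sum.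
Qed.

End Tuples.

Section EuclidBounds.
Variable R : realType.

Lemma euclid_norm_le_sum n (x : euclid R n) :
  `|x| <= \sum_j `|(x : 'rV[R]_n) 0 j|.
Proof.
have S0 : 0 <= \sum_j `|(x : 'rV[R]_n) 0 j| by exact: sumr_ge0.
rewrite euclid_normE -(ler_pXn2r (ltn0Sn 1)) ?nnegrE ?sqrtr_ge0//.
rewrite sqr_sqrtr; last by apply: sumr_ge0 => i _; exact: sqr_ge0.
rewrite [leRHS]expr2 mulr_suml; apply: ler_sum => i _.
rewrite -real_normK ?num_real// expr2 ler_wpM2l//.
by rewrite (bigD1 i)//= lerDl sumr_ge0.
Qed.

Lemma lapp_row m n (L : linhom R m n) (x : euclid R m) :
  lapp L x = \sum_j (x : 'rV[R]_m) 0 j *: lapp L (delta_mx 0 j : 'rV[R]_m).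
Proof.
rewrite {1}[x]row_sum_delta /lapp linear_sum.
by apply: eq_bigr => j _; rewrite linearZ.
Qed.

Lemma linhom_norm_le_sum m n (L : linhom R m n) :
  `|L| <= \sum_j `|lapp L (delta_mx 0 j : 'rV[R]_m)|.
Proof.
apply: ge_sup; first by exists `|lapp L 0|; exists 0 => //=; rewrite normr0.
move=> _ [v /= v1 <-]; rewrite lapp_row.
apply: (le_trans (ler_norm_sum _ _ _)); apply: ler_sum => j _.
rewrite normrZ ler_piMl//; exact: le_trans (euclid_coord_le v j) v1.
Qed.

End EuclidBounds.

Section AffineMatch.
Variables (R : realType) (m n q : nat).

(** Along the moment curve scaled by [r], an affine map becomes a polynomial of degree at most [m]
    in the parameter, to which [node_match] applies; the scaling puts the factor [r] on the linear
    parts. *)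
Lemma affine_match : exists2 C : R, 0 <= C &
  forall (phi psi : 'I_q -> poly1 R m n) (r e : R), 0 < r ->
    (forall v, `|v| < r -> mdist (dsum (fun i => poly1_eval (phi i) v))
                                 (dsum (fun i => poly1_eval (psi i) v)) <= e) ->
    exists p : 'S_q, forall i, `|(phi i).1 - (psi (p i)).1| <= C * e /\
                               r * `|(phi i).2 - (psi (p i)).2| <= C * e.
Proof.
pose M := (q`! * m.+1).+1.
(* Small enough for the points x k below to lie in the unit ball. *)
pose t (k : 'I_M) : R := k%:R / (M * m.+1)%:R.
have Mm0 : 0 < (M * m.+1)%:R :> R by rewrite ltr0n muln_gt0.
have tI : injective t.
  move=> k l /(mulIf (lt0r_neq0 _)); rewrite invr_gt0 => /(_ Mm0) /eqP.
  by rewrite eqr_nat => /eqP/val_inj.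
have t0 k : 0 <= t k by rewrite /t divr_ge0.
have tm k : t k * m.+1%:R < 1.
  rewrite /t mulrAC ltr_pdivrMr// mul1r -natrM ltr_nat ltn_pmul2r//.
have t1 k : t k <= 1.
  by apply: le_trans (ltW (tm k)); rewrite ler_peMr// ler1n.
have [C C0 hC] := node_match tI.
exists (m.+1%:R * C); first by rewrite mulr_ge0.
move=> phi psi r e r0 close.
pose x k : euclid R m := (\row_j t k ^+ j.+1 : 'rV[R]_m).
have x1 k : `|x k| < 1.
  apply: (le_lt_trans (euclid_norm_le_sum _)); apply: le_lt_trans (tm k).
  apply: (@le_trans _ _ (\sum_(j < m) t k)).
    apply: ler_sum => j _; rewrite mxE ger0_norm ?exprn_ge0//.
    by rewrite exprS ler_piMr// exprn_ile1.
  by rewrite sumr_const card_ord -[leLHS]mulr_natr ler_wpM2l// ler_nat.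
(* The coefficients of that polynomial: the constant part in degree 0 and the scaled image of the
   basis vector [j'] in degree [j' + 1]. *)
pose w (chi : 'I_q -> poly1 R m n) i (j : 'I_m.+1) : euclid R n :=
  if unlift ord0 j is Some j' then r *: lapp (chi i).2 (delta_mx 0 j' : 'rV[R]_m)
  else (chi i).1.
have wE chi i k : \sum_(j < m.+1) t k ^+ j *: w chi i j
    = poly1_eval (chi i) (r *: x k).
  rewrite big_ord_recl expr0 scale1r /w unlift_none /poly1_eval; congr (_ + _).
  rewrite lapp_row; apply: eq_bigr => j _; rewrite liftK !mxE scalerA mulrC.
  by rewrite mulrC -scalerA scalerA mulrC.
have [|p hp] := hC _ (w phi) (w psi) e.
  move=> k; have rx : `|r *: x k| < r.
    by rewrite normrZ gtr0_norm// gtr_pMr.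
  have [p hp] := mdist_dsum_match (close _ rx).
  exists p => i; under eq_bigr do rewrite scalerBr.
  by rewrite sumrB !wE; exact: hp.
have Ce (i : 'I_q) : 0 <= C * e by exact: (le_trans (normr_ge0 _) (hp i ord0)).
exists p => i; split.
  have := hp i ord0; rewrite /w unlift_none => /le_trans; apply.
  by rewrite -mulrA ler_peMl ?(Ce i)// ler1n.
rewrite -[X in X * _]gtr0_norm// -normrZ.
apply: (le_trans (linhom_norm_le_sum _)).
apply: (@le_trans _ _ (\sum_(j < m) C * e)).
  apply: ler_sum => j _; have := hp i (lift ord0 j).
  rewrite /w liftK -scalerBr /lapp. by rewrite lfunE/= add_lfunE opp_lfunE.
rewrite sumr_const card_ord -[leLHS]mulr_natl -mulrA ler_wpM2r ?(Ce i)//.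
by rewrite ler_nat.
Qed.

End AffineMatch.

(** * First order approximation *)

Section FirstOrder.
Variables (R : realType) (m n q : nat).
Implicit Types (f : euclid R m -> Qspace q (euclid R n)) (a x : euclid R m)
  (phi psi : 'I_q -> poly1 R m n).

(* At x = a this forces f a to be the tuple of the values (phi i).1. *)
Definition first_order f a phi := forall e : R, 0 < e -> \forall x \near a,
  mdist (f x) (dsum (fun i => poly1_eval (phi i) (x - a))) <= e * `|x - a|.

Lemma poly1_eval0 (chi : poly1 R m n) : poly1_eval chi 0 = chi.1.
Proof. by rewrite /poly1_eval /lapp linear0 addr0. Qed.

Lemma Paf_dsum a phi x :
  Paf a (dsum phi) x = dsum (fun i => poly1_eval (phi i) (x - a)).
Proof. by rewrite /Paf Qmap_dsum. Qed.

Lemma first_order_base f a phi : first_order f a phi ->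
  f a = dsum (fun i => (phi i).1).
Proof.
move=> /(_ 1 ltr01)/nbhs_singleton; rewrite subrr normr0 mulr0.
have -> : (fun i => poly1_eval (phi i) 0) = (fun i => (phi i).1).
  by apply/funext => i; exact: poly1_eval0.
by move=> h; apply: mdist_positivity; apply/eqP; rewrite eq_le h mdist_ge0.
Qed.

(** On a ball of radius [s] the two tuples differ by at most [2 * d * s]. After division by [s] the
    linear parts differ by a multiple of [d], and [s <= 1] gives the same for the values; [d] is
    arbitrarily small. *)
Lemma first_order_unique f a phi psi :
  first_order f a phi -> first_order f a psi -> dsum phi = dsum psi.
Proof.
move=> hphi hpsi; have [C C0 hC] := affine_match R m n q.
apply: mdist_positivity; apply/eqP; rewrite eq_le mdist_ge0 andbT.
apply/ler_addgt0Pr => e e0; rewrite add0r.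
pose K := q%:R * (C * 2 * 2) + 1.
have K0 : 0 < K by rewrite ltr_wpDl// !mulr_ge0.
pose d := e / K.
have d0 : 0 < d by rewrite divr_gt0.
have /nbhs_ballP[r /= r0 hr] : \forall x \near a,
    mdist (f x) (dsum (fun i => poly1_eval (phi i) (x - a))) <= d * `|x - a| /\
    mdist (f x) (dsum (fun i => poly1_eval (psi i) (x - a))) <= d * `|x - a|.
  exact: filterI (hphi d d0) (hpsi d d0).
pose s := Num.min r 1.
have s1 : s <= 1 by rewrite /s ge_min lexx orbT.
have s0 : 0 < s by rewrite lt_min r0 ltr01.
have [|p hp] := hC phi psi s (2 * d * s) s0.
  move=> v vs; have [|h1 h2] := hr (a + v).
    by rewrite -ball_normE/= opprD addNKr normrN (lt_le_trans vs)// ge_min lexx.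
  have av : a + v - a = v by rewrite addrC addKr.
  rewrite av in h1 h2.
  apply: (le_trans (metric_triangle _ (f (a + v)) _)).
  rewrite metric_sym; apply: (le_trans (lerD h1 h2)).
  have : d * `|v| <= d * s by rewrite ler_wpM2l ?(ltW d0) ?(ltW vs).
  by lra.
apply: (le_trans (match_mdist_dsum (p := p) (e := C * 2 * 2 * d) _)) => [i|].
  have [h1 h2] := hp i; rewrite [leLHS]/Num.norm/= /poly1_norm/=.
  have h3 : `|(phi i).2 - (psi (p i)).2| <= C * (2 * d).
    rewrite -(ler_pM2l s0); apply: (le_trans h2).
    by rewrite (_ : s * (C * (2 * d)) = C * (2 * d * s))//; ring.
  have h4 : C * (2 * d * s) <= C * (2 * d).
    have : C * d * s <= C * d * 1 by rewrite ler_wpM2l// mulr_ge0// ltW.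
    by lra.
  by apply: (le_trans (lerD (le_trans h1 h4) h3)); lra.
rewrite mulrA /d mulrCA ger_pMr// ler_pdivrMr// mul1r.
by rewrite /K lerDl.
Unshelve. all: by end_near. Qed.

Lemma affine_mapE (A : euclid R m -> euclid R n) a x : affine_map A ->
  A x = A a + lapp (linear_part A) (x - a).
Proof.
move=> hA; rewrite -[x in LHS](subrK a) /lapp.
have := linear_partE x hA; have := linear_partE a hA.
rewrite /lapp linearB/= => -> ->; rewrite subrK.
by rewrite opprB addrA addrC subrKA addrCA subrr addr0.
Qed.

Lemma affine_approx_first_order f a (A : 'I_q -> euclid R m -> euclid R n) :
  affine_approx f a A -> first_order f a (fun i => (A i a, linear_part (A i))).
Proof.
move=> [hA fa hlim] e e0.
have evalE x : (fun i => poly1_eval (A i a, linear_part (A i)) (x - a))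
    = (fun i => A i x).
  by apply/funext => i; rewrite (affine_mapE a x (hA i)).
move/cvgrPdist_le: hlim => /(_ e e0); rewrite near_withinE.
(* The punctured limit says nothing at [x = a], where the equality for [f a] is used. *)
apply: filterS => x; rewrite evalE; have [->|xa] := eqVneq x a.
  by rewrite fa mdistxx mulr_ge0// ltW.
move=> /(_ isT); rewrite sub0r normrN ger0_norm ?mulr_ge0 ?mdist_ge0//.
by rewrite ler_pdivrMl ?normr_gt0 ?subr_eq0// mulrC.
Qed.

Lemma first_order_affine_approx f a phi : first_order f a phi ->
  let A i x := poly1_eval (phi i) (x - a) in
  affine_approx f a A /\ forall i, (A i a, linear_part (A i)) = phi i.
Proof.
move=> hphi A.
have A0 i v : A i v - A i 0 = lapp (phi i).2 v.
  rewrite /A /poly1_eval opprD addrACA subrr add0r /lapp -linearB/=.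
  by rewrite sub0r opprK subrK.
have linA i : affine_map (A i).
  by move=> c x y; rewrite !A0 /lapp linearP.
split; last first.
  move=> i; rewrite [RHS]surjective_pairing; congr pair.
    by rewrite /A subrr poly1_eval0.
  by apply/lfunP => v; have := linear_partE v (linA i); rewrite A0.
split => //.
  rewrite (first_order_base hphi); congr dsum; apply/funext => i.
  by rewrite /A subrr poly1_eval0.
apply/cvgrPdist_le => e e0; rewrite near_withinE.
have := hphi e e0; apply: filterS => x hx xa.
rewrite sub0r normrN ger0_norm ?mulr_ge0 ?mdist_ge0//.
by rewrite ler_pdivrMl ?normr_gt0 ?subr_eq0// mulrC.
Qed.

Lemma affinely_approximableP f a :
  affinely_approximable f a <-> exists phi, first_order f a phi.
Proof.
split=> [[A /affine_approx_first_order h]|[phi /first_order_affine_approx[h _]]].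
  by eexists; exact: h.
by eexists; exact: h.
Qed.

Lemma T1f_first_order f a phi : first_order f a phi -> T1f f a = dsum phi.
Proof.
move=> hphi; apply: xget_unique.
  have [h E] := first_order_affine_approx hphi.
  by eexists; [exact: h|congr dsum; apply/funext => i; rewrite E].
move=> _ [A /affine_approx_first_order hA ->].
exact: first_order_unique hA hphi.
Qed.

Lemma Df_first_order f a phi : first_order f a phi ->
  Df f a = dsum (fun i => (phi i).2).
Proof.
move=> hphi; apply: xget_unique.
  have [h E] := first_order_affine_approx hphi.
  eexists; [exact: h|congr dsum; apply/funext => i].
  by have := congr1 snd (E i).
move=> _ [A /affine_approx_first_order hA ->].
have := congr1 (Qmap snd) (first_order_unique hA hphi).
by rewrite !Qmap_dsum.
Qed.

End FirstOrder.

(** * The mean value inequality *)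

Section EuclidMeanValue.
Variables (R : realType) (m n q : nat).

Lemma mean_value_inequality : exists2 C : R, 0 <= C &
  forall (f : euclid R m -> Qspace q (euclid R n)) (a x : euclid R m) (eta : R),
    0 < eta ->
    (forall t : R, 0 <= t <= 1 ->
       [/\ affinely_approximable f (a + t *: (x - a)),
           {for a + t *: (x - a), continuous (Df f)} &
           mdist (Df f (a + t *: (x - a))) (Df f a) <= eta]) ->
    mdist (f x) (Paf a (T1f f a) x) <= C * eta * `|x - a|.
Proof.
pose M := (q`! * n).+1; pose t (k : 'I_M) : R := k%:R.
have tI : injective t by move=> k l /eqP; rewrite eqr_nat => /eqP/val_inj.
have [C C0 hC] := node_match tI.
(* The value at node [t k] of the polynomial whose coefficients are the coordinates of [y], so that
   [node_match] can recombine the forms. *)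
pose lam k (y : euclid R n) : R := \sum_(j < n) t k ^+ j * (y : 'rV[R]_n) 0 j.
pose La := \sum_k \sum_(j < n) `|t k ^+ j| + 1.
have La0 : 0 < La by rewrite ltr_wpDl// sumr_ge0// => k _; exact: sumr_ge0.
have lamB k y y' : lam k (y - y') = lam k y - lam k y'.
  by rewrite /lam -sumrB; apply: eq_bigr => j _; rewrite !mxE mulrBr.
have lamZ k c y : lam k (c *: y) = c * lam k y.
  by rewrite /lam mulr_sumr; apply: eq_bigr => j _; rewrite !mxE mulrCA.
have lam_le k y : `|lam k y| <= La * `|y|.
  apply: (@le_trans _ _ ((\sum_(j < n) `|t k ^+ j|) * `|y|)).
    rewrite mulr_suml; apply: (le_trans (ler_norm_sum _ _ _)).
    by apply: ler_sum => j _; rewrite normrM ler_wpM2l// euclid_coord_le.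
  rewrite ler_wpM2r// /La [X in _ <= X + _](bigD1 k)//= -addrA lerDl addr_ge0//.
  by do 2 (apply: sumr_ge0 => ? _); exact: normr_ge0.
have lam_lapp k (L L' : linhom R m n) v :
    `|lam k (lapp L v) - lam k (lapp L' v)| <= La * (`|L' - L| * `|v|).
  rewrite distrC -lamB; apply: (le_trans (lam_le _ _)).
  rewrite ler_wpM2l ?(ltW La0)//; apply: le_trans (ler_lapp _ _).
  by rewrite /lapp add_lfunE opp_lfunE.
exists (q%:R * (n%:R * (C * ((q%:R * 3 + 2) * La)))).
  have LaW := ltW La0; do 3 (apply: mulr_ge0 => //).
  by apply: mulr_ge0 => //; rewrite addr_ge0// mulr_ge0.
move=> f a x eta eta0 hf; set v := x - a; pose y (s : R) := a + s *: v.
have /choice[phi hphi] : forall s : R, exists phi, 0 <= s <= 1 ->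
    first_order f (y s) phi.
  move=> s; have [s01|s01] := boolP (0 <= s <= 1); last by exists (fun=> 0).
  by have [/affinely_approximableP[ph hph] _ _] := hf s s01; exists ph.
have y0 : y 0 = a by rewrite /y scale0r addr0.
have y1 : y 1 = x by rewrite /y scale1r addrC subrK.
have I0 : 0 <= (0 : R) <= 1 by rewrite lexx ler01.
have I1 : 0 <= (1 : R) <= 1 by rewrite lexx ler01.
have := hphi 0 I0; rewrite y0 => phi0.
have := hphi 1 I1; rewrite y1 => phi1.
rewrite (T1f_first_order phi0) Paf_dsum (first_order_base phi1) -/v.
have [v0|vN0] := eqVneq v 0.
  have xa : x = a by apply/eqP; rewrite -subr_eq0 -/v v0.
  rewrite -(first_order_base phi1) xa (first_order_base phi0) v0 normr0 mulr0.
  rewrite (_ : (fun i => poly1_eval _ _) = (fun i => (phi 0 i).1)) ?mdistxx//.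
  by apply/funext => i; rewrite poly1_eval0.
have nv : 0 < `|v| by rewrite normr_gt0.
have yB s r : y r - y s = (r - s) *: v.
  by rewrite /y opprD addrACA subrr add0r scalerBl.
have vel s : 0 <= s <= 1 -> Df f (y s) = dsum (fun i => (phi s i).2).
  by move=> s01; exact: Df_first_order (hphi s s01).
have y_cont s : y r @[r --> s] --> y s.
  by apply: cvgD; [exact: cvg_cst|apply: cvgZ; [exact: cvg_id|exact: cvg_cst]].
(* Derivatives within [eta] have velocities [lam k (lapp L v)] within [eta * La * |v|]. *)
pose e := eta * La * `|v|.
have e0 : 0 < e by rewrite !mulr_gt0.
have branches k : exists p : 'S_q, forall i,
    `|lam k (phi 1 (p i)).1 - lam k (phi 0 i).1 - lam k (lapp (phi 0 i).2 v)|
      <= q%:R * (3 * e) + 2 * e.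
  apply: (@branches_mean_value _ _ (fun s i => lam k (phi s i).1)
     (fun s i => lam k (lapp (phi s i).2 v)) e) => //.
  - move=> s s01 d d0.
    have d1 : 0 < d / (La * `|v|) by rewrite divr_gt0 ?mulr_gt0.
    have : \forall r \near s, mdist (f (y r))
        (dsum (fun i => poly1_eval (phi s i) (y r - y s)))
        <= d / (La * `|v|) * `|y r - y s| := y_cont s _ (hphi s s01 _ d1).
    apply: filterS => r hr r01.
    have := hr; rewrite /= (first_order_base (hphi r r01)) yB metric_sym.
    move=> /mdist_dsum_match[p hp]; exists p => i.
    have := hp i; rewrite distrC /poly1_eval opprD addrA => hpi.
    rewrite -lamB -lamZ -lamB.
    have <- : lapp (phi s i).2 ((r - s) *: v) = (r - s) *: lapp (phi s i).2 v.
      exact: linearZ.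
    apply: (le_trans (lam_le _ _)); apply: (le_trans (ler_wpM2l (ltW La0) hpi)).
    rewrite normrZ le_eqVlt; apply/orP; left; apply/eqP.
    by field; rewrite !gt_eqF.
  - move=> s s01 d d0.
    have d1 : 0 < d / (La * `|v|) by rewrite divr_gt0 ?mulr_gt0.
    have [_ hc _] := hf s s01.
    have /metricType_numDomainType.cvgrPdist_le/(_ _ d1) := cvg_comp _ _ (y_cont s) hc.
    apply: filterS => r hr r01; have := hr; rewrite /= -/(y s) !vel//.
    move=> /mdist_dsum_match[p hp]; exists p => i; apply: (le_trans (lam_lapp _ _ _ _)).
    apply: (@le_trans _ _ (La * (d / (La * `|v|) * `|v|))).
      by rewrite ler_wpM2l ?(ltW La0)// ler_wpM2r.
    rewrite le_eqVlt; apply/orP; left; apply/eqP.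
    by field; rewrite !gt_eqF.
  move=> s s01; have [_ _] := hf s s01; rewrite -/(y s) -[X in mdist _ (Df _ X)]y0 !vel//.
  rewrite metric_sym => /mdist_dsum_match[p hp]; exists p => i.
  apply: (le_trans (lam_lapp _ _ _ _)).
  rewrite (_ : e = La * (eta * `|v|)); last by rewrite /e; ring.
  by rewrite ler_wpM2l ?(ltW La0)// ler_wpM2r.
(* Each form has its own matching; from these one permutation valid for all coordinates is
   extracted. *)
have [|p hp] := hC R^o (fun i j => (poly1_eval (phi 0 i) v : 'rV[R]_n) 0 j)
    (fun i j => ((phi 1 i).1 : 'rV[R]_n) 0 j) (q%:R * (3 * e) + 2 * e).
  move=> k; have [p hp] := branches k; exists p => i.
  rewrite [X in `|X|](_ : _ = lam k (poly1_eval (phi 0 i) v - (phi 1 (p i)).1)).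
    rewrite lamB distrC -lamB.
    by have := hp i; rewrite -!lamB -addrA -opprD.
  by apply: eq_bigr => j _; rewrite !mxE.
rewrite metric_sym.
apply: (le_trans (match_mdist_dsum (p := p)
  (e := n%:R * (C * (q%:R * (3 * e) + 2 * e))) _)) => [i|].
  apply: (le_trans (euclid_norm_le_sum _)).
  rewrite -[n in leRHS]card_ord mulr_natl -sumr_const; apply: ler_sum => j _.
  by have := hp i j; rewrite !mxE.
by rewrite /e le_eqVlt; apply/orP; left; apply/eqP; ring.
Qed.

End EuclidMeanValue.

(** A closed box is compact for the supremum norm, and the identity to the Euclidean norm is
    continuous. The half-side [r / (m + 1)] keeps the box inside the ball of radius [r]. *)
Lemma compact_nbhs (R : realType) (m : nat) (a : euclid R m)
    (U : set (euclid R m)) : nbhs a U ->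
  exists K, [/\ compact K, K `<=` U & nbhs a K].
Proof.
move=> /nbhs_ballP[r /= r0 rU]; pose s := r / (m%:R + 1).
have m1 : 0 < m%:R + 1 :> R by rewrite ltr_wpDl.
have s0 : 0 < s by rewrite divr_gt0.
pose a' : 'rV[R]_m := a.
pose box : set 'rV[R]_m := [set v | forall i, `[a' 0 i - s, a' 0 i + s]%classic (v 0 i)].
have box_norm (v w : 'rV[R]_m) d : 0 <= d -> (forall i, `|w 0 i - v 0 i| <= d) ->
    `|(w : euclid R m) - v| <= m%:R * d.
  move=> d0 h; apply: (le_trans (euclid_norm_le_sum _)).
  rewrite -[m in leRHS]card_ord mulr_natl -sumr_const; apply: ler_sum => j _.
  by rewrite !mxE.
pose K : set (euclid R m) := (id : 'rV[R]_m -> euclid R m) @` box.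
exists K; split.
- apply: continuous_compact; last first.
    apply: (@rV_compact R m (fun i => `[a' 0 i - s, a' 0 i + s]%classic)) => i.
    exact: segment_compact.
  apply: continuous_subspaceT => v V /nbhs_ballP[e /= e0 eV].
  have e1 : 0 < e / (m%:R + 1) by rewrite divr_gt0.
  apply/(@nbhs_ballP _ 'rV[R]_m); exists (e / (m%:R + 1)) => // w vw /=.
  apply: eV; rewrite -ball_normE/=.
  apply: (@le_lt_trans _ _ (m%:R * (e / (m%:R + 1)))).
    apply: box_norm => [|i]; first exact: ltW.
    by have [_ /(_ 0 i)] := vw; rewrite /ball/= => /ltW.
  by rewrite mulrCA gtr_pMr// ltr_pdivrMr// mul1r ltrDl.
- move=> _ [v hv <-]; apply: rU; rewrite -ball_normE/=.
  apply: (@le_lt_trans _ _ (m%:R * s)).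
    apply: box_norm => [|i]; first by rewrite ltW.
    by have := hv i; rewrite /= in_itv/= ler_norml /a'; lra.
  by rewrite /s mulrCA gtr_pMr// ltr_pdivrMr// mul1r ltrDl.
- apply/nbhs_ballP; exists s => // w; rewrite -ball_normE/= => aw.
  exists w => // i; rewrite /= in_itv/=.
  have := le_lt_trans (euclid_coord_le _ i) aw; rewrite !mxE ltr_norml /a'.
  by lra.
Qed.

(** * Equivalence of the three conditions *)

Lemma mdist_Qmap_le (R : realType) (q : nat) (V W : normedModType R)
    (g : V -> W) : (forall x y, `|g x - g y| <= `|x - y|) ->
  forall S T : Qspace q V, mdist (Qmap g S) (Qmap g T) <= mdist S T.
Proof.
move=> hg S T; have [y ->] := dsum_surj S; have [z ->] := dsum_surj T.
rewrite !Qmap_dsum !Qspace_mdistE !Qdist_dsum.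
have [p ->] := matching_dist_attained y z.
by apply: le_trans (matching_dist_le _ _ p) _; apply: ler_sum => i _; exact: hg.
Qed.

Section Equivalence.
Variables (R : realType) (m n q : nat).
Variables (Omega : set (euclid R m)) (f : euclid R m -> Qspace q (euclid R n)).
Hypothesis hOmega : open Omega.

Lemma within_open_mdistP (V : metricType R) (g : euclid R m -> V) :
  {within Omega, continuous g} <->
  forall a, Omega a -> forall e : R, 0 < e ->
    \forall x \near a, mdist (g a) (g x) <= e.
Proof.
rewrite continuous_open_subspace//; split=> [h a /mem_set/h|h a /set_mem aO].
  by move/metricType_numDomainType.cvgrPdist_le.
apply: (@metricType_numDomainType.cvgrPdist_le R V _ (nbhs a) _ g (g a)).2.
by move=> e e0; exact: h.
Qed.

(** [Df f] is the image of [T1f f] under the second projection, which does not increase the sum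
    norm. *)
Lemma T1f_continuous_Df_continuous :
  (forall a, Omega a -> affinely_approximable f a) ->
  {within Omega, continuous (T1f f)} -> {within Omega, continuous (Df f)}.
Proof.
move=> happ /within_open_mdistP hT; apply/within_open_mdistP => a aO e e0.
have DfE x : Omega x -> Df f x = Qmap snd (T1f f x).
  move=> /happ/affinely_approximableP[phi hphi].
  by rewrite (Df_first_order hphi) (T1f_first_order hphi) Qmap_dsum.
near=> x.
have xO : Omega x by near: x; exact: open_nbhs_nbhs.
rewrite !DfE//; apply: (@le_trans _ _ (mdist (T1f f a) (T1f f x))).
  apply: (@mdist_Qmap_le R q (poly1 R m n) (linhom R m n) snd) => y z.
  by rewrite [leRHS]/Num.norm/= /poly1_norm/= lerDr.
by near: x; exact: hT.
Unshelve. all: by end_near. Qed.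

Definition whitney_field (Phi : euclid R m -> Qspace q (poly1 R m n)) :=
  (forall a, Omega a -> Paf a (Phi a) a = f a) /\
  (forall K : set (euclid R m), compact K -> K `<=` Omega ->
   forall eps : R, 0 < eps ->
   exists2 delta : R, 0 < delta &
     forall a b, K a -> K b -> `|b - a| < delta ->
     forall x, ball a `|b - a| x ->
       mdist (Paf a (Phi a) x) (Paf b (Phi b) x) <= eps * `|b - a|).

Lemma whitney_first_order Phi a phi : whitney_field Phi -> Omega a ->
  Phi a = dsum phi -> first_order f a phi.
Proof.
move=> [hbase hW] aO Pa e e0.
have [K [cK KO aK]] := compact_nbhs (open_nbhs_nbhs (conj hOmega aO)).
have [d d0 hd] := hW K cK KO e e0.
near=> x.
have Kx : K x by near: x.
have -> : dsum (fun i => poly1_eval (phi i) (x - a)) = Paf a (Phi a) x.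
  by rewrite Pa Paf_dsum.
rewrite -hbase; last exact: KO.
have [->|xa] := eqVneq x a; first by rewrite mdistxx mulr_ge0// ltW.
(* Swapping the roles of a and x puts the evaluation point at the centre of
   the open ball. *)
have xad : `|a - x| < d.
  by near: x; apply/nbhs_ballP; exists d => // x; rewrite -ball_normE.
rewrite distrC; apply: (hd x a Kx (nbhs_singleton aK) xad x).
by apply: ballxx; rewrite normr_gt0 subr_eq0 eq_sym.
Unshelve. all: by end_near. Qed.

(** Recentred at [a], the tuple at [b] is compared with the one at [a] on the ball of radius
    [|b - a|] by [affine_match]. Undoing the recentring costs the linear parts at [b], bounded
    through those at [a], times [|b - a|]. *)
Lemma whitney_continuous Phi a : whitney_field Phi -> Omega a ->
  forall e : R, 0 < e -> \forall x \near a, mdist (Phi a) (Phi x) <= e.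
Proof.
move=> [_ hW] aO e e0.
have [C C0 hC] := affine_match R m n q.
have [K [cK KO aK]] := compact_nbhs (open_nbhs_nbhs (conj hOmega aO)).
have [phi Pa] := dsum_surj (Phi a).
pose N := \sum_i `|(phi i).2|.
have N0 : 0 <= N by exact: sumr_ge0.
(* [d1] and [d2] each keep one half of the final bound [q%:R * (3 * C * d1 + N * d2)] below
   [e / 2]. *)
pose d1 := e / (2 * (q%:R * (3 * C) + 1)).
have d10 : 0 < d1.
  by rewrite divr_gt0// mulr_gt0// ltr_wpDl// !mulr_ge0.
pose d2 := e / (2 * (q%:R * N + 1)).
have d20 : 0 < d2.
  by rewrite divr_gt0// mulr_gt0// ltr_wpDl// mulr_ge0.
have [d d0 hd] := hW K cK KO d1 d10.
have dist_lt (c : R) : 0 < c -> \forall x \near a, `|x - a| < c.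
  move=> c0; apply/nbhs_ballP; exists c => // x.
  by rewrite -ball_normE/= distrC.
near=> b.
have Kb : K b by near: b.
have [->|ba] := eqVneq b a; first by rewrite mdistxx ltW.
pose r := `|b - a|.
have r0 : 0 < r by rewrite normr_gt0 subr_eq0.
have rd : `|b - a| < d by near: b; exact: dist_lt.
have /ltW r1 : `|b - a| < 1 by near: b; exact: dist_lt.
have /ltW r2 : `|b - a| < d2 by near: b; exact: dist_lt.
have [psi Pb] := dsum_surj (Phi b).
pose psi' i : poly1 R m n := ((psi i).1 + lapp (psi i).2 (a - b), (psi i).2).
have [|p hp] := hC phi psi' r (d1 * r) r0.
  move=> v vr; have := hd a b (nbhs_singleton aK) Kb rd (a + v).
  rewrite Pa Pb !Paf_dsum.
  have -> : a + v - a = v by rewrite addrC addKr.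
  have -> : (fun i => poly1_eval (psi i) (a + v - b))
      = (fun i => poly1_eval (psi' i) v).
    apply/funext => i; rewrite /poly1_eval /psi'/= -[RHS]addrA; congr (_ + _).
    have <- : lapp (psi i).2 (a - b + v)
        = lapp (psi i).2 (a - b) + lapp (psi i).2 v by exact: linearD.
    by rewrite addrAC.
  by apply; rewrite -ball_normE/= opprD addNKr normrN.
rewrite Pa Pb.
apply: (le_trans (match_mdist_dsum (p := p) (e := 3 * C * d1 + N * d2) _)).
  move=> i; have [h1 h2] := hp i.
  have L2 : `|(phi i).2 - (psi (p i)).2| <= C * d1.
    rewrite -(ler_pM2l r0); apply: (le_trans h2).
    by rewrite le_eqVlt; apply/orP; left; apply/eqP; ring.
  have NL : `|(psi (p i)).2| <= N + C * d1.
    have Ni : `|(phi i).2| <= N by rewrite /N (bigD1 i)//= lerDl sumr_ge0.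
    have := ler_distD (phi i).2 (psi (p i)).2 0; rewrite !subr0 distrC.
    by move: L2 Ni; lra.
  have L3 : `|lapp (psi (p i)).2 (a - b)| <= (N + C * d1) * r.
    apply: (le_trans (ler_lapp _ _)); rewrite distrC -/r.
    by rewrite ler_wpM2r// ltW.
  have L1 : `|(phi i).1 - (psi (p i)).1| <= C * (d1 * r) + (N + C * d1) * r.
    have -> : (phi i).1 - (psi (p i)).1
        = (phi i).1 - (psi' (p i)).1 + lapp (psi (p i)).2 (a - b).
      by rewrite /psi'/= opprD -addrA subrK.
    by apply: (le_trans (ler_normD _ _)); exact: lerD.
  rewrite [leLHS]/Num.norm/= /poly1_norm/=.
  have h4 : C * d1 * r <= C * d1 * 1 by rewrite ler_wpM2l// mulr_ge0// ltW.
  have h5 : N * r <= N * d2 by rewrite ler_wpM2l.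
  by move: L1 L2; lra.
have e1 : d1 * (2 * (q%:R * (3 * C) + 1)) = e.
  by rewrite /d1 divfK// gt_eqF// mulr_gt0// ltr_wpDl// !mulr_ge0.
have e2 : d2 * (2 * (q%:R * N + 1)) = e.
  by rewrite /d2 divfK// gt_eqF// mulr_gt0// ltr_wpDl// mulr_ge0.
by move: e1 e2 (d10) (d20); lra.
Unshelve. all: by end_near. Qed.

Lemma whitney_T1f_continuous Phi : whitney_field Phi ->
  (forall a, Omega a -> affinely_approximable f a) /\
  {within Omega, continuous (T1f f)}.
Proof.
move=> hPhi.
have T1E a : Omega a -> T1f f a = Phi a.
  move=> aO; have [phi Pa] := dsum_surj (Phi a); rewrite Pa.
  exact: T1f_first_order (whitney_first_order hPhi aO Pa).
split=> [a aO|].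
  apply/affinely_approximableP; have [phi Pa] := dsum_surj (Phi a).
  by exists phi; exact: whitney_first_order hPhi aO Pa.
apply/within_open_mdistP => a aO e e0; near=> x.
have xO : Omega x by near: x; exact: open_nbhs_nbhs.
by rewrite !T1E//; near: x; exact: whitney_continuous.
Unshelve. all: by end_near. Qed.

Lemma Df_continuous_whitney :
  (forall a, Omega a -> affinely_approximable f a) ->
  {within Omega, continuous (Df f)} -> whitney_field (T1f f).
Proof.
move=> happ hD; split=> [a aO|K cK KO eps eps0].
  have /affinely_approximableP[phi hphi] := happ a aO.
  rewrite (T1f_first_order hphi) Paf_dsum (first_order_base hphi) subrr.
  by congr dsum; apply/funext => i; rewrite poly1_eval0.
have [C C0 hC] := mean_value_inequality R m n q.
(* Here [b] ranges over all nearby points, not only over [K]; near-covering compactness turns the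
   local radii into one [d]. *)
pose P (d : R) a := forall b, `|b - a| < d -> forall x, ball a `|b - a| x ->
  mdist (Paf a (T1f f a) x) (Paf b (T1f f b) x) <= eps * `|b - a|.
have : \forall d \near (0 : R)^'+, K `<=` P d.
  move/compact_near_coveringP: cK; apply => a0 Ka0.
  have a0O := KO _ Ka0.
  (* The derivatives differ by at most [2 * eta], and [|x - a| + |x - b| <= 3 * |b - a|]; hence the
     factor 6. *)
  pose eta := eps / (6 * C + 1).
  have C1 : 0 < 6 * C + 1 by rewrite ltr_wpDl// mulr_ge0.
  have eta0 : 0 < eta by rewrite divr_gt0.
  have /within_open_mdistP/(_ a0 a0O eta eta0) hDa0 := hD.
  have : \forall x \near a0, Omega x /\ mdist (Df f a0) (Df f x) <= eta.
    by near=> x; split; near: x => //; exact: open_nbhs_nbhs.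
  move=> /nbhs_ballP[r /= r0]; rewrite -ball_normE => hr.
  have close a x : `|a - a0| < r / 2 -> `|x - a| < r / 2 ->
      mdist (f x) (Paf a (T1f f a) x) <= C * (2 * eta) * `|x - a|.
    move=> aa0 xa; apply: hC; first by rewrite mulr_gt0.
    move=> t /andP[t0 t1].
    have inr y : `|y - a| < r / 2 -> Omega y /\ mdist (Df f a0) (Df f y) <= eta.
      move=> ya; apply: hr => /=.
      by have := ler_distD a a0 y; rewrite (distrC a0 a) (distrC a y); lra.
    have [yO hy] : Omega (a + t *: (x - a)) /\
        mdist (Df f a0) (Df f (a + t *: (x - a))) <= eta.
      apply: inr; rewrite addrC addKr normrZ ger0_norm//.
      by apply: le_lt_trans xa; rewrite ler_piMl.
    have [_ ha] : Omega a /\ mdist (Df f a0) (Df f a) <= eta.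
      by apply: inr; rewrite subrr normr0 divr_gt0.
    split; first exact: happ.
      by move: hD; rewrite continuous_open_subspace// => /(_ _ (mem_set yO)).
    apply: (le_trans (metric_triangle _ (Df f a0) _)).
    rewrite [X in X + _]metric_sym (le_trans (lerD hy ha))//.
    by rewrite -mulr2n mulr_natl.
  near=> a d; move=> b /= bd x; rewrite -ball_normE/= => xb.
  have aa0 : `|a - a0| < r / 6.
    near: a; apply/nbhs_ballP; exists (r / 6); first by rewrite /= divr_gt0.
    by move=> a; rewrite -ball_normE/= distrC.
  have dr : d < r / 6 by near: d; apply: nbhs_right_lt; rewrite divr_gt0.
  have := ler_distD a b a0; have := ler_distD a x b.
  rewrite (distrC a b) (distrC x a) => xb1 ba0.
  have h1 : mdist (f x) (Paf a (T1f f a) x) <= C * (2 * eta) * `|x - a|.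
    by apply: close; rewrite ?(distrC x a); lra.
  have h2 : mdist (f x) (Paf b (T1f f b) x) <= C * (2 * eta) * `|x - b|.
    by apply: close; lra.
  apply: (le_trans (metric_triangle _ (f x) _)); rewrite metric_sym.
  apply: (le_trans (lerD h1 h2)); rewrite -mulrDr.
  apply: (@le_trans _ _ (C * (2 * eta) * (3 * `|b - a|))).
    apply: ler_wpM2l; first by rewrite mulr_ge0// mulr_ge0// ltW.
    by rewrite (distrC x a); lra.
  have -> : C * (2 * eta) * (3 * `|b - a|) = 6 * C * eta * `|b - a| by ring.
  rewrite ler_wpM2r// /eta mulrCA ger_pMr// ler_pdivrMr// mul1r.
  by rewrite lerDl.
move=> hK; near (0 : R)^'+ => d.
exists d; first by near: d; exact: nbhs_right_gt.
move=> a b Ka _ bd x.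
have : K `<=` P d by near: d.
by move=> /(_ a Ka b bd x).
Unshelve. all: by end_near. Qed.

End Equivalence.

Unset Implicit Arguments.

Theorem theorem5p5 (R : realType) (m n q : nat)
    (hm : (0 < m)%N) (hn : (0 < n)%N) (hq : (0 < q)%N)
    (Omega : set (euclid R m)) (hOmega : open Omega)
    (f : euclid R m -> Qspace q (euclid R n)) :
  [<-> (forall a, Omega a -> affinely_approximable f a) /\
         {within Omega, continuous (Df f)};
       exists Phi : euclid R m -> Qspace q (poly1 R m n),
         (forall a, Omega a -> Paf a (Phi a) a = f a) /\
         (forall K : set (euclid R m), compact K -> K `<=` Omega ->
          forall eps : R, 0 < eps ->
          exists2 delta : R, 0 < delta &
            forall a b, K a -> K b -> `|b - a| < delta ->
            forall x, ball a `|b - a| x ->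
              mdist (Paf a (Phi a) x) (Paf b (Phi b) x) <= eps * `|b - a|);
       (forall a, Omega a -> affinely_approximable f a) /\
         {within Omega, continuous (T1f f)}].
Proof.
tfae.
- by move=> [happ hD]; exists (T1f f); exact: Df_continuous_whitney.
- by move=> [Phi hPhi]; exact: whitney_T1f_continuous hPhi.
- by move=> [happ hT]; split=> //; exact: T1f_continuous_Df_continuous.
Qed.
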